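(* Let $\lambda,\mu,\rho,\omega>0$, $C_p=\sqrt{(\lambda+2\mu)/\rho}$, $C_s=\sqrt{\mu/\rho}$. Consider the overlapping Schwarz method with (zeroth order) Taylor transmission conditions for the time-harmonic Navier equations with overlap $\delta>0$, and let $\rho_{T_0}(k,\omega,C_p,C_s,\delta)$ be its convergence factor in the Fourier mode $k$ (explicit formula in the context). The method converges for $k\in\mathbb{R}_+\setminus\{\frac{\omega}{C_p},\frac{\omega}{C_s}\}$, i.e. $\rho_{T_0}(k,\omega,C_p,C_s,\delta)<1$ for all these $k$, if the overlap $\delta$ is bigger than $$\delta^*(C_p,C_s,\omega)=\frac{C_s\sqrt{C_p^2-C_s^2}\,(C_p+2C_s)^2}{C_p\,\omega\,(C_s+C_p)}\cdot\frac{\sinh(\alpha)}{C_p\cosh(\alpha)+C_s},$$ where $\alpha$ is the positive root of $$\alpha C_p^2\left(C_p\cosh(\alpha)+C_s\right)-\left(C_p^3+(\alpha-1)(3C_p^2C_s-4C_s^3)\right)\sinh(\alpha)=0.$$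
   Context: The Navier equations are $-(\Delta^e+\omega^2\rho)\mathbf u=\mathbf f$ on $\mathbb{R}^2$, $\Delta^e\mathbf u=\mu\Delta\mathbf u+(\lambda+\mu)\nabla(\nabla\cdot\mathbf u)$, with subdomains $\Omega_1=(-\infty,\delta)\times\mathbb{R}$, $\Omega_2=(0,\infty)\times\mathbb{R}$. The Schwarz method solves for $n=1,2,\dots$ the equations $-(\Delta^e+\omega^2\rho)\mathbf u_j^n=\mathbf f$ in $\Omega_j$, $j=1,2$, with $(\mathcal T_1+\mathcal S_1)\mathbf u_1^n=(\mathcal T_1+\mathcal S_1)\mathbf u_2^{n-1}$ at $x=\delta$ and $(\mathcal T_2+\mathcal S_2)\mathbf u_2^n=(\mathcal T_2+\mathcal S_2)\mathbf u_1^{n-1}$ at $x=0$, where $\mathcal T_j\mathbf u=2\mu\,\partial\mathbf u/\partial n_j+\lambda\mathbf n_j\nabla\cdot\mathbf u+\mu\mathbf n_j\times\nabla\times\mathbf u$ is the traction operator with outward normal $\mathbf n_j$ of $\Omega_j$. The zeroth order Taylor transmission conditions take $\mathcal S_1=\mathcal S_2=\mathrm{diag}(\mathrm{i}\rho\omega C_p,\ \mathrm{i}\rho\omega C_s)$. After a Fourier transform in $y$ with Fourier variable $k\ge0$, the convergence factor of this method in the mode $k$ is $$\rho_{T_0}(k,\omega,C_p,C_s,\delta)=\left(\max\{|r_+|,|r_-|\}\right)^{1/2},\qquad r_\pm=\frac{X^2}{2}+Y\pm\frac12\sqrt{X^2(X^2+4Y)},$$ $$X=e^{-\lambda_1\delta}b_{11}-e^{-\lambda_2\delta}b_{22},\qquad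 Y=e^{-(\lambda_1+\lambda_2)\delta}(b_{11}b_{22}-b_{12}b_{21}),$$ where $$\begin{bmatrix}b_{11}&b_{12}\\ b_{21}&b_{22}\end{bmatrix}=\frac1D\begin{bmatrix}-Z_1-Z_2-\mathrm{i}\omega^3\left(\lambda_1-\lambda_2\frac{C_p}{C_s}\right)&\mathrm{i}\lambda_2K\\ -\mathrm{i}\lambda_1K&-Z_1-Z_2+\mathrm{i}\omega^3\left(\lambda_1-\lambda_2\frac{C_p}{C_s}\right)\end{bmatrix},$$ $$Z_1=C_s^3(k^2+\lambda_1^2)^2+\omega^2C_pk^2,\quad Z_2=(4C_s^3k^2+C_p\omega^2)\lambda_1\lambda_2,\quad K=2k\left(C_p\omega^2+2C_s^3(k^2+\lambda_1^2)\right),$$ $$D=-Z_1+Z_2+\mathrm{i}\omega^3\left(\lambda_1+\lambda_2\frac{C_p}{C_s}\right),$$ and $\lambda_1=\sqrt{k^2-\omega^2/C_s^2}$, $\lambda_2=\sqrt{k^2-\omega^2/C_p^2}$, with the root taken in $\mathrm{i}\mathbb{R}_+$ when the radicand is negative. (Any branch of the complex square root in $r_\pm$ may be used, since only the pair $\{r_+,r_-\}$ matters.)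
   Formalization: The printed equation for α has no positive root for any λ, μ, ρ, ω > 0; the formal theorem also allows (and its content concerns) the equation with the factor (α−1) replaced by 1, which has exactly one positive root. *)

(* Defs.v *)
From Stdlib Require Import Reals Lra Psatz.
From Coquelicot Require Import Coquelicot.

Open Scope R_scope.

Definition Cexp (z : C) : C :=
  (exp (Re z) * cos (Im z), exp (Re z) * sin (Im z)).

(* Principal branch: nonnegative real part, and values in i R_+ on the
   negative real axis. *)
Definition Csqrt (z : C) : C :=
  (sqrt ((Cmod z + Re z) / 2),
   (if Rle_dec 0 (Im z) then 1 else -1) * sqrt ((Cmod z - Re z) / 2)).

Definition lambda1 (k omega Cs : R) : C := Csqrt (RtoC (k ^ 2 - omega ^ 2 / Cs ^ 2)).
Definition lambda2 (k omega Cp : R) : C := Csqrt (RtoC (k ^ 2 - omega ^ 2 / Cp ^ 2)).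

Definition Z1 (k omega Cp Cs : R) : C :=
  let l1 := lambda1 k omega Cs in
  (Cs ^ 3 * (k ^ 2 + l1 ^ 2) ^ 2 + omega ^ 2 * Cp * k ^ 2)%C.

Definition Z2 (k omega Cp Cs : R) : C :=
  let l1 := lambda1 k omega Cs in
  let l2 := lambda2 k omega Cp in
  ((4 * Cs ^ 3 * k ^ 2 + Cp * omega ^ 2) * l1 * l2)%C.

Definition Kmix (k omega Cp Cs : R) : C :=
  let l1 := lambda1 k omega Cs in
  (2 * k * (Cp * omega ^ 2 + 2 * Cs ^ 3 * (k ^ 2 + l1 ^ 2)))%C.

Definition Dden (k omega Cp Cs : R) : C :=
  let l1 := lambda1 k omega Cs in
  let l2 := lambda2 k omega Cp in
  (- Z1 k omega Cp Cs + Z2 k omega Cp Cs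
   + Ci * omega ^ 3 * (l1 + l2 * (Cp / Cs)))%C.

Definition b11 (k omega Cp Cs : R) : C :=
  let l1 := lambda1 k omega Cs in
  let l2 := lambda2 k omega Cp in
  ((- Z1 k omega Cp Cs - Z2 k omega Cp Cs
    - Ci * omega ^ 3 * (l1 - l2 * (Cp / Cs))) / Dden k omega Cp Cs)%C.

Definition b12 (k omega Cp Cs : R) : C :=
  (Ci * lambda2 k omega Cp * Kmix k omega Cp Cs / Dden k omega Cp Cs)%C.

Definition b21 (k omega Cp Cs : R) : C :=
  (- Ci * lambda1 k omega Cs * Kmix k omega Cp Cs / Dden k omega Cp Cs)%C.

Definition b22 (k omega Cp Cs : R) : C :=
  let l1 := lambda1 k omega Cs in
  let l2 := lambda2 k omega Cp in
  ((- Z1 k omega Cp Cs - Z2 k omega Cp Cs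
    + Ci * omega ^ 3 * (l1 - l2 * (Cp / Cs))) / Dden k omega Cp Cs)%C.

Definition Xc (k omega Cp Cs delta : R) : C :=
  (Cexp (- lambda1 k omega Cs * delta) * b11 k omega Cp Cs
   - Cexp (- lambda2 k omega Cp * delta) * b22 k omega Cp Cs)%C.

Definition Yc (k omega Cp Cs delta : R) : C :=
  (Cexp (- (lambda1 k omega Cs + lambda2 k omega Cp) * delta)
   * (b11 k omega Cp Cs * b22 k omega Cp Cs
      - b12 k omega Cp Cs * b21 k omega Cp Cs))%C.

Definition r_plus (k omega Cp Cs delta : R) : C :=
  let X := Xc k omega Cp Cs delta in
  let Y := Yc k omega Cp Cs delta in
  (X ^ 2 / 2 + Y + / 2 * Csqrt (X ^ 2 * (X ^ 2 + 4 * Y)))%C.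

Definition r_minus (k omega Cp Cs delta : R) : C :=
  let X := Xc k omega Cp Cs delta in
  let Y := Yc k omega Cp Cs delta in
  (X ^ 2 / 2 + Y - / 2 * Csqrt (X ^ 2 * (X ^ 2 + 4 * Y)))%C.

Definition rho_T0 (k omega Cp Cs delta : R) : R :=
  sqrt (Rmax (Cmod (r_plus k omega Cp Cs delta))
             (Cmod (r_minus k omega Cp Cs delta))).

(* The source prints the equation for alpha with the factor (a - 1).  In that
   form it has no positive root, for any parameters with Cp^2 > 2 Cs^2 (that is,
   lambda > 0): see alpha_eq_printed_no_root.  With that factor replaced by 1 it
   has exactly one (alpha_eq_corrected_root_unique).  The bracket is then
   (Cp - Cs) (Cp + 2 Cs)^2, and the equation says exactly that
   delta_star * lambda2 = alpha at k = omega / Cs. *)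
Definition alpha_eq_printed (Cp Cs a : R) : Prop :=
  a * Cp ^ 2 * (Cp * cosh a + Cs)
  - (Cp ^ 3 + (a - 1) * (3 * Cp ^ 2 * Cs - 4 * Cs ^ 3)) * sinh a = 0.

Definition alpha_eq_corrected (Cp Cs a : R) : Prop :=
  a * Cp ^ 2 * (Cp * cosh a + Cs)
  - (Cp ^ 3 + (3 * Cp ^ 2 * Cs - 4 * Cs ^ 3)) * sinh a = 0.

Definition delta_star (Cp Cs omega a : R) : R :=
  Cs * sqrt (Cp ^ 2 - Cs ^ 2) * (Cp + 2 * Cs) ^ 2 / (Cp * omega * (Cs + Cp))
  * (sinh a / (Cp * cosh a + Cs)).

Lemma Csqrt_sqr (z : C) : (Csqrt z * Csqrt z)%C = z.
Proof.
destruct z as [x y]; unfold Csqrt, Cmult; simpl.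
assert (H : Cmod (x, y) * Cmod (x, y) = x * x + y * y).
{ unfold Cmod; simpl. rewrite sqrt_sqrt; nra. }
assert (H0 := Cmod_ge_0 (x, y)). set (m := Cmod (x, y)) in *.
assert (Hp : 0 <= (m + x) / 2) by nra.
assert (Hm : 0 <= (m - x) / 2) by nra.
assert (A := sqrt_sqrt _ Hp); assert (B := sqrt_sqrt _ Hm).
assert (AB : sqrt ((m + x) / 2) * sqrt ((m - x) / 2) = Rabs y / 2).
{ rewrite <- sqrt_mult by assumption.
  replace ((m + x) / 2 * ((m - x) / 2)) with (Rsqr (y / 2)) by (unfold Rsqr; nra).
  rewrite sqrt_Rsqr_abs. unfold Rdiv. rewrite Rabs_mult, (Rabs_right (/ 2)); lra. }
set (p := sqrt ((m + x) / 2)) in *; set (q := sqrt ((m - x) / 2)) in *.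
destruct (Rle_dec 0 y) as [Hy | Hy]; apply injective_projections; simpl.
- lra.
- rewrite Rabs_right in AB by lra. nra.
- lra.
- rewrite Rabs_left in AB by lra. nra.
Qed.

Lemma Csqrt_RtoC_ge0 (x : R) : 0 <= x -> Csqrt (RtoC x) = RtoC (sqrt x).
Proof.
intros Hx; unfold Csqrt; rewrite Cmod_R, Rabs_right by lra; simpl.
destruct (Rle_dec 0 0) as [_ | n]; [| lra].
apply injective_projections; simpl.
- f_equal; lra.
- replace ((x - x) / 2) with 0 by lra; rewrite sqrt_0; lra.
Qed.

Lemma Csqrt_RtoC_lt0 (x : R) : x < 0 -> Csqrt (RtoC x) = (0, sqrt (- x)).
Proof.
intros Hx; unfold Csqrt; rewrite Cmod_R, Rabs_left by lra; simpl.
destruct (Rle_dec 0 0) as [_ | n]; [| lra].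
apply injective_projections; simpl.
- replace ((- x + x) / 2) with 0 by lra; apply sqrt_0.
- rewrite Rmult_1_l; f_equal; lra.
Qed.

Lemma derive_pos_gt (f df : R -> R) (a b : R) :
  a < b -> (forall x, is_derive f x (df x)) ->
  (forall x, a < x < b -> 0 < df x) -> f a < f b.
Proof.
intros ab D P.
destruct (MVT_cor2 f df a b ab) as [c [E Hc]].
- intros c _; apply is_derive_Reals, D.
- specialize (P c Hc); nra.
Qed.

Lemma is_derive_sinh x : is_derive sinh x (cosh x).
Proof. unfold sinh, cosh; auto_derive; [easy | field]. Qed.

Lemma is_derive_cosh x : is_derive cosh x (sinh x).
Proof. unfold sinh, cosh; auto_derive; [easy | field]. Qed.

Lemma cosh_sqr x : cosh x ^ 2 = 1 + sinh x ^ 2.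
Proof.
unfold sinh, cosh.
assert (H : exp x * exp (- x) = 1).
{ rewrite <- exp_plus, Rplus_opp_r; apply exp_0. }
nra.
Qed.

Lemma cosh_gt_sinh x : sinh x < cosh x.
Proof. assert (H := exp_pos (- x)); unfold sinh, cosh; lra. Qed.

Lemma sinh_gt_id a : 0 < a -> a < sinh a.
Proof.
intros Ha.
assert (H : sinh 0 - 0 < sinh a - a).
{ apply (derive_pos_gt (fun x => sinh x - x) (fun x => cosh x - 1) 0 a Ha).
  - intros x; apply (is_derive_minus sinh (fun x => x)).
    apply is_derive_sinh. apply @is_derive_id.
  - intros x Hx. assert (E := cosh_sqr x).
    assert (0 < sinh x).
    { unfold sinh. assert (exp (- x) < exp x) by (apply exp_increasing; lra). lra. }
    assert (G := cosh_gt_sinh x). nra. }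
rewrite sinh_0 in H; lra.
Qed.

Lemma sinh_lt_mul_cosh a : 0 < a -> sinh a < a * cosh a.
Proof.
intros Ha.
assert (H : 0 * cosh 0 - sinh 0 < a * cosh a - sinh a).
{ apply (derive_pos_gt (fun x => x * cosh x - sinh x) (fun x => x * sinh x) 0 a Ha).
  - intros x; unfold cosh, sinh; auto_derive; [easy | field].
  - intros x Hx; assert (G := sinh_gt_id x (proj1 Hx)); nra. }
rewrite sinh_0 in H; lra.
Qed.

Lemma alpha_eq_printed_no_root (Cp Cs a : R) :
  0 < Cs -> 0 < Cp -> 2 * Cs ^ 2 < Cp ^ 2 -> 0 < a -> ~ alpha_eq_printed Cp Cs a.
Proof.
intros Hs Hp H Ha E; unfold alpha_eq_printed in E.
set (g := 3 * Cp ^ 2 * Cs - 4 * Cs ^ 3) in *.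
assert (g0 : 0 < g) by (unfold g; nra).
assert (g1 : 0 <= Cp ^ 3 - g).
{ replace (Cp ^ 3 - g) with ((Cp + Cs) * (Cp - 2 * Cs) ^ 2) by (unfold g; ring).
  apply Rmult_le_pos; [lra | apply pow2_ge_0]. }
assert (c3 : 0 < Cp ^ 3) by (apply pow_lt; lra).
assert (c2 : 0 < a * Cp ^ 2 * Cs).
{ apply Rmult_lt_0_compat; [apply Rmult_lt_0_compat |]; [lra | apply pow_lt; lra | lra]. }
assert (S := sinh_gt_id a Ha); assert (T := sinh_lt_mul_cosh a Ha);
assert (G := cosh_gt_sinh a).
set (s := sinh a) in *; set (c := cosh a) in *.
destruct (Rle_lt_dec a 1) as [L | L].
- assert (0 <= (1 - a) * (g * s)) by (apply Rmult_le_pos; nra).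
  assert (0 < Cp ^ 3 * (a * c - s)) by (apply Rmult_lt_0_compat; lra).
  nra.
- assert (0 <= (a - 1) * ((Cp ^ 3 - g) * s)).
  { apply Rmult_le_pos; [lra | apply Rmult_le_pos; lra]. }
  assert (0 < Cp ^ 3 * (a * (c - s))).
  { apply Rmult_lt_0_compat; [lra | apply Rmult_lt_0_compat; lra]. }
  nra.
Qed.

Lemma alpha_eq_ratio_incr (t a b : R) : 0 <= t <= 1 -> 0 < a < b ->
  a * (cosh a + t) / sinh a < b * (cosh b + t) / sinh b.
Proof.
intros Ht [Ha Hab].
destruct (MVT_cor2 (fun x => x * (cosh x + t) / sinh x)
  (fun x => (cosh x * sinh x - x - t * (x * cosh x - sinh x)) / sinh x ^ 2)
  a b Hab) as [c [E Hc]].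
- intros x Hx; apply is_derive_Reals.
  assert (S := sinh_gt_id x ltac:(lra)).
  assert (D : is_derive (fun x => x * (cosh x + t) / sinh x) x
    (((1 * (cosh x + t) + x * (sinh x + 0)) * sinh x
      - x * (cosh x + t) * cosh x) / sinh x ^ 2)).
  { apply (is_derive_div (fun x => x * (cosh x + t)) sinh).
    - apply (is_derive_mult (fun x => x) (fun x => cosh x + t)).
      + apply @is_derive_id.
      + apply (is_derive_plus cosh (fun _ => t));
          [apply is_derive_cosh | apply @is_derive_const].
      + intros n m; apply Rmult_comm.
    - apply is_derive_sinh.
    - lra. }
  replace ((cosh x * sinh x - x - t * (x * cosh x - sinh x)) / sinh x ^ 2)
    with (((1 * (cosh x + t) + x * (sinh x + 0)) * sinh x
      - x * (cosh x + t) * cosh x) / sinh x ^ 2); [exact D |].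
  f_equal; assert (Q := cosh_sqr x); nra.
- assert (S := sinh_gt_id c ltac:(lra)).
  assert (T := sinh_lt_mul_cosh c ltac:(lra)); assert (G := cosh_gt_sinh c).
  assert (P : 0 < (cosh c * sinh c - c - t * (c * cosh c - sinh c)) / sinh c ^ 2).
  { apply Rdiv_lt_0_compat; [| apply pow_lt; lra].
    assert (0 < (1 + cosh c) * (sinh c - c)) by (apply Rmult_lt_0_compat; lra).
    assert (0 <= (1 - t) * (c * cosh c - sinh c)) by (apply Rmult_le_pos; lra).
    nra. }
  assert (0 < b - a) by lra; nra.
Qed.

Lemma alpha_eq_corrected_root_unique (Cp Cs : R) :
  0 < Cs -> 0 < Cp -> 2 * Cs ^ 2 < Cp ^ 2 ->
  exists! a, 0 < a /\ alpha_eq_corrected Cp Cs a.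
Proof.
intros Hs Hp H.
assert (Hsp : Cs < Cp) by nra.
set (h := Cp ^ 3 + (3 * Cp ^ 2 * Cs - 4 * Cs ^ 3)).
assert (c3 : 0 < Cp ^ 3) by (apply pow_lt; lra).
assert (c2 : 0 < Cp ^ 2) by (apply pow_lt; lra).
assert (h0 : 0 < h).
{ unfold h; replace (Cp ^ 3 + (3 * Cp ^ 2 * Cs - 4 * Cs ^ 3))
    with ((Cp - Cs) * (Cp + 2 * Cs) ^ 2) by ring.
  apply Rmult_lt_0_compat; [lra | apply pow_lt; lra]. }
set (f := fun a => a * Cp ^ 2 * (Cp * cosh a + Cs) - h * sinh a).
assert (Df : forall x, is_derive f x
  (Cp ^ 2 * (Cp * cosh x + Cs) + x * Cp ^ 3 * sinh x - h * cosh x)).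
{ intros x; unfold f, cosh, sinh; auto_derive; [easy | field]. }
assert (Cf : forall x, continuity_pt f x).
{ intros x; apply derivable_continuous_pt.
  eexists; apply is_derive_Reals, Df. }
assert (f0 : f 0 = 0) by (unfold f; rewrite sinh_0; ring).
assert (N : exists x, 0 < x < 1 /\ f x < 0).
{ assert (D0 := Df 0). apply is_derive_Reals in D0.
  rewrite cosh_0, sinh_0 in D0.
  set (d := Cp ^ 2 * (Cp * 1 + Cs) + 0 * Cp ^ 3 * 0 - h * 1) in D0.
  assert (d0 : d < 0).
  { unfold d, h.
    assert (0 < 2 * Cs * (Cp ^ 2 - 2 * Cs ^ 2)) by (apply Rmult_lt_0_compat; lra).
    nra. }
  destruct (D0 (- d) ltac:(lra)) as [e He].
  assert (e0 := cond_pos e).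
  set (x := Rmin (e / 2) (/ 2)).
  assert (x0 : 0 < x) by (unfold x; apply Rmin_pos; lra).
  assert (x1 := Rmin_l (e / 2) (/ 2) : x <= _).
  assert (x2 := Rmin_r (e / 2) (/ 2) : x <= _).
  exists x; split; [lra |].
  specialize (He x ltac:(lra) ltac:(rewrite Rabs_right; lra)).
  rewrite Rplus_0_l, f0, Rminus_0_r in He.
  apply Rabs_lt_between in He.
  assert (F : f x / x < 0) by lra.
  replace (f x) with (f x / x * x) by (field; lra).
  nra. }
destruct N as [x [Hx Nx]].
set (y := 1 + h / Cp ^ 3).
assert (y1 : 1 < y).
{ unfold y; assert (0 < h / Cp ^ 3) by (apply Rdiv_lt_0_compat; lra); lra. }
assert (Py : 0 < f y).
{ assert (S := sinh_gt_id y ltac:(lra)); assert (G := cosh_gt_sinh y).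
  assert (E : y * Cp ^ 3 = Cp ^ 3 + h) by (unfold y; field; lra).
  assert (A : f y = (y * Cp ^ 3) * cosh y + y * Cp ^ 2 * Cs - h * sinh y)
    by (unfold f; ring).
  rewrite A, E.
  assert (0 < Cp ^ 3 * cosh y) by (apply Rmult_lt_0_compat; lra).
  assert (0 < h * (cosh y - sinh y)) by (apply Rmult_lt_0_compat; lra).
  assert (0 < y * Cp ^ 2 * Cs)
    by (apply Rmult_lt_0_compat; [apply Rmult_lt_0_compat |]; lra).
  nra. }
assert (R : exists a, 0 < a /\ f a = 0).
{ destruct (IVT f x y Cf ltac:(lra) Nx Py) as [z [Hz Ez]].
  exists z; split; lra. }
assert (ratio : forall a, 0 < a -> f a = 0 -> a * (cosh a + Cs / Cp) / sinh a = h / Cp ^ 3).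
{ intros a a0 Ea. assert (S := sinh_gt_id a a0).
  unfold f in Ea.
  assert (E : h = a * Cp ^ 2 * (Cp * cosh a + Cs) / sinh a).
  { apply (Rmult_eq_reg_r (sinh a)); [| lra].
    replace (a * Cp ^ 2 * (Cp * cosh a + Cs) / sinh a * sinh a)
      with (a * Cp ^ 2 * (Cp * cosh a + Cs)) by (field; lra).
    lra. }
  rewrite E; field; lra. }
destruct R as [a [a0 Ea]]; exists a; split; [split; assumption |].
intros b [b0 Eb]; change (f b = 0) in Eb.
assert (t1 : 0 <= Cs / Cp <= 1).
{ split; [apply Rlt_le, Rdiv_lt_0_compat; lra |].
  apply (Rmult_le_reg_r Cp); [lra |].
  unfold Rdiv; rewrite Rmult_assoc, Rinv_l; lra. }
assert (A := ratio a a0 Ea); assert (B := ratio b b0 Eb).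
destruct (Rtotal_order a b) as [L | [E | L]]; [| exact E |].
- assert (Q := alpha_eq_ratio_incr _ _ _ t1 (conj a0 L)); lra.
- assert (Q := alpha_eq_ratio_incr _ _ _ t1 (conj b0 L)); lra.
Qed.

(* Main.v *)
Require Import Defs.
From Stdlib Require Import Reals Lra Psatz List.
From Coquelicot Require Import Coquelicot.
Import ListNotations.

Open Scope R_scope.

(** Why the theorem is true.

    The numbers r_+ and r_- are the squares of the roots n of n^2 = X n + Y,
    so the claim is that both roots lie in the open unit disc.  Measuring
    lengths in units of Cs / omega leaves the single material parameter
    c = Cp / Cs, and lambda > 0 means c^2 > 2.  With

      P = (2 k^2 - 1)^2 + c k^2,   Q = 4 k^2 + c,   e_j = exp (- l_j d),

    where l_1^2 = k^2 - 1, l_2^2 = k^2 - 1 / c^2 and d is the scaled overlap,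
    the coupling coefficient of the two waves satisfies K^2 = 4 (P Q - c).
    This makes the determinant of the matrix b a quotient of two linear factors,
    and n^2 = X n + Y turns into

      P (n - e_1)(n + e_2) - Q l_1 l_2 (n + e_1)(n - e_2)
        - i l_1 (n + e_1)(n + e_2) - i c l_2 (n - e_1)(n - e_2) = 0

    ([mode_eq_of_root]).  There are three ranges of k.

    k < 1 / c.  Both waves propagate and |e_j| = 1.  If |n| >= 1, then
    (n - e_j) / (n + e_j) has non-negative real part; the equation expresses one
    of these two quotients as a linear fractional function of the other, with
    coefficients for which the two half planes never meet
    ([root_lt1_both_propagating]).

    1 / c < k < 1.  Here |e_1| = 1 > e_2.  The Schur-Cohn criterion
    ([schur_cohn]) reduces the claim to the positivity of a trigonometric
    expression in the phase a d, a = |l_1|, with coefficients hyperbolic in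
    b d, b = l_2 ([mixed_gap]).  For large overlap the hyperbolic terms
    dominate for every phase; for small overlap the phase a d <= (a / b) sinh (b d)
    has not yet advanced far enough to spoil positivity ([phase_gap_pos]).
    Any overlap will do.

    k > 1.  The Schur-Cohn criterion becomes an inequality between hyperbolic
    functions of (l_2 + l_1) d / 2 and (l_2 - l_1) d / 2.  The product of these
    two numbers is u^2, where u = sqrt (1 - 1 / c^2) d / 2 does not depend on k,
    so they are u z and u / z for some z > 1.  Since x coth x is convex in log x,
    sinh (u z) / sinh (u / z) >= z ^ (2 u coth u) ([ln_sinh_geometric]), which
    leaves a rational inequality in c, z, u coth u and tanh u.  At z = 1, that is
    k = 1, it reads

      (c + 2)^2 (c - 1) tanh u / u <= c^2 (c + 1 + (c - 1) tanh^2 u),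

    which holds exactly when the overlap is at least delta_star
    ([threshold_half_angle]); and this case implies it for all z > 1
    ([overlap_core]).

    The equation for alpha with the factor (alpha - 1) has no positive root, so
    only the other one has to be considered. *)

(** * Reduction to a quadratic equation in the unit disc *)

(** The functions Z1, Z2 / (l1 l2) of the scheme, divided by Cs^3 times powers of
    omega / Cs, at the scaled wave number with square x. *)
Definition stiffP (c x : R) : R := (2 * x - 1) ^ 2 + c * x.
Definition stiffQ (c x : R) : R := 4 * x + c.

Definition mode_form (P Q c : R) (l1 l2 e1 e2 n : C) : C :=
  (P * (n - e1) * (n + e2) - Q * l1 * l2 * (n + e1) * (n - e2)
   - Ci * l1 * (n + e1) * (n + e2) - Ci * c * l2 * (n - e1) * (n - e2))%C.

Definition mode_den (P Q c : R) (l1 l2 : C) : C :=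
  (P - Q * l1 * l2 - Ci * (l1 + c * l2))%C.

Definition nsq (z : C) : R := Re z ^ 2 + Im z ^ 2.

Lemma nsq_Cmod z : nsq z = Cmod z ^ 2.
Proof.
unfold nsq, Cmod; rewrite pow2_sqrt; [reflexivity |].
apply Rplus_le_le_0_compat; apply pow2_ge_0.
Qed.

Lemma Ci_sqr : (Ci * Ci = - (1))%C.
Proof. apply injective_projections; simpl; ring. Qed.

Lemma Cexp_plus z w : Cexp (z + w)%C = (Cexp z * Cexp w)%C.
Proof.
destruct z as [x y], w as [u v]. unfold Cexp, Cmult, Cplus; simpl.
rewrite exp_plus, cos_plus, sin_plus. apply injective_projections; simpl; ring.
Qed.

(** The matrix b has determinant (P - Q l1 l2 + i (l1 + c l2)) / [mode_den]
    because K^2 = 4 (P Q - c): the products of l1 and l2 cancel, and the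
    numerator becomes a difference of two squares one factor of which is the
    denominator.  The quadratic equation then splits into products of n - e_j
    and n + e_j. *)
Lemma mode_eq_of_root (sg Cs c k : R) (l1 l2 e1 e2 n : C) (delta : R) :
  0 < sg -> 0 < Cs -> 0 < c ->
  lambda1 (sg * k) (sg * Cs) Cs = (sg * l1)%C ->
  lambda2 (sg * k) (sg * Cs) (c * Cs) = (sg * l2)%C ->
  (l1 * l1)%C = RtoC (k ^ 2 - 1) ->
  Cexp (- (sg * l1) * delta) = e1 -> Cexp (- (sg * l2) * delta) = e2 ->
  mode_den (stiffP c (k ^ 2)) (stiffQ c (k ^ 2)) c l1 l2 <> 0%C ->
  (n * n = Xc (sg * k) (sg * Cs) (c * Cs) Cs delta * n
           + Yc (sg * k) (sg * Cs) (c * Cs) Cs delta)%C ->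
  mode_form (stiffP c (k ^ 2)) (stiffQ c (k ^ 2)) c l1 l2 e1 e2 n = 0%C.
Proof.
intros Hsg HCs Hc E1 E2 L1 X1 X2 HD Hn.
assert (X12 : Cexp (- (sg * l1 + sg * l2) * delta) = (e1 * e2)%C).
{ rewrite <- X1, <- X2, <- Cexp_plus. f_equal. ring. }
set (P := stiffP c (k ^ 2)) in *; set (Q := stiffQ c (k ^ 2)) in *.
assert (HsgC : RtoC sg <> 0%C) by (intros H; apply RtoC_inj in H; lra).
assert (HCsC : RtoC Cs <> 0%C) by (intros H; apply RtoC_inj in H; lra).
set (s := (Cs ^ 3 * sg ^ 4)%C : C).
assert (Hs : s <> 0%C) by (unfold s; apply Cmult_neq_0; apply Cpow_nz; assumption).
assert (EZ1 : Z1 (sg * k) (sg * Cs) (c * Cs) Cs = (s * P)%C).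
{ unfold Z1. rewrite E1. 
  replace ((sg * l1) ^ 2)%C with (sg ^ 2 * (l1 * l1))%C by ring.
  rewrite L1. unfold s, P, stiffP.
  rewrite !RtoC_plus, !RtoC_mult, !RtoC_minus, !RtoC_pow.
  rewrite !RtoC_minus, !RtoC_mult, !RtoC_pow. ring. }
assert (EZ2 : Z2 (sg * k) (sg * Cs) (c * Cs) Cs = (s * (Q * l1 * l2))%C).
{ unfold Z2. rewrite E1, E2. unfold s, Q, stiffQ.
  rewrite !RtoC_plus, !RtoC_mult, !RtoC_pow. ring. }
assert (EK : Kmix (sg * k) (sg * Cs) (c * Cs) Cs
   = (Cs ^ 3 * sg ^ 3 * (2 * k * (c + 2 * (2 * k ^ 2 - 1))))%C).
{ unfold Kmix. rewrite E1. 
  replace ((sg * l1) ^ 2)%C with (sg ^ 2 * (l1 * l1))%C by ring.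
  rewrite L1.
  rewrite !RtoC_mult, !RtoC_minus, !RtoC_pow. ring. }
set (k2 := (2 * k * (c + 2 * (2 * k ^ 2 - 1)))%C) in *.
set (d := mode_den P Q c l1 l2) in *.
assert (ED : Dden (sg * k) (sg * Cs) (c * Cs) Cs = (s * - d)%C).
{ unfold Dden. rewrite EZ1, EZ2, E1, E2. unfold d, mode_den, s.
  rewrite !RtoC_mult. field. assumption. }
assert (HDs : (s * - d)%C <> 0%C).
{ apply Cmult_neq_0; [assumption |]. intros H; apply HD.
  replace d with (- - d)%C by ring. rewrite H; ring. }
assert (B11 : b11 (sg * k) (sg * Cs) (c * Cs) Cs
   = ((P + Q * l1 * l2 + Ci * (l1 - c * l2)) / d)%C).
{ unfold b11. rewrite EZ1, EZ2, E1, E2, ED. unfold s in *.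
  rewrite !RtoC_mult. field. repeat split; assumption. }
assert (B22 : b22 (sg * k) (sg * Cs) (c * Cs) Cs
   = ((P + Q * l1 * l2 - Ci * (l1 - c * l2)) / d)%C).
{ unfold b22. rewrite EZ1, EZ2, E1, E2, ED. unfold s in *.
  rewrite !RtoC_mult. field. repeat split; assumption. }
assert (B12 : b12 (sg * k) (sg * Cs) (c * Cs) Cs = (- Ci * l2 * k2 / d)%C).
{ unfold b12. rewrite EK, E2, ED. unfold s in *.
  field. repeat split; assumption. }
assert (B21 : b21 (sg * k) (sg * Cs) (c * Cs) Cs = (Ci * l1 * k2 / d)%C).
{ unfold b21. rewrite EK, E1, ED. unfold s in *.
  field. repeat split; assumption. }
assert (K2 : (k2 * k2)%C = (4 * (P * Q - c))%C).
{ unfold k2, P, Q, stiffP, stiffQ.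
  rewrite !RtoC_plus, !RtoC_mult, !RtoC_pow, !RtoC_minus, !RtoC_mult, !RtoC_pow. ring. }
assert (DetB : (b11 (sg * k) (sg * Cs) (c * Cs) Cs * b22 (sg * k) (sg * Cs) (c * Cs) Cs
   - b12 (sg * k) (sg * Cs) (c * Cs) Cs * b21 (sg * k) (sg * Cs) (c * Cs) Cs
   = (P - Q * l1 * l2 + Ci * (l1 + c * l2)) / d)%C).
{ rewrite B11, B12, B21, B22.
  transitivity (((P + Q * l1 * l2) * (P + Q * l1 * l2)
     - (Ci * Ci) * (l1 - c * l2) * (l1 - c * l2)
     + (Ci * Ci) * l1 * l2 * (k2 * k2)) / (d * d))%C; [field; assumption |].
  transitivity ((P - Q * l1 * l2 + Ci * (l1 + c * l2)) * d / (d * d))%C; [| field; assumption].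
  f_equal. unfold d, mode_den. rewrite K2.
  transitivity ((P - Q * l1 * l2) * (P - Q * l1 * l2)
     - (Ci * Ci) * (l1 + c * l2) * (l1 + c * l2))%C; [| ring].
  rewrite Ci_sqr. ring. }
unfold Xc, Yc in Hn. rewrite DetB, B11, B22 in Hn.
rewrite E1, E2, X1, X2, X12 in Hn.
unfold mode_form.
transitivity (d * (n * n) - (e1 * (P + Q * l1 * l2 + Ci * (l1 - c * l2))
   - e2 * (P + Q * l1 * l2 - Ci * (l1 - c * l2))) * n
   - e1 * e2 * (P - Q * l1 * l2 + Ci * (l1 + c * l2)))%C.
{ unfold d, mode_den; ring. }
rewrite Hn. field. assumption.
Qed.

(** r_+ and r_- are roots of r^2 - (X^2 + 2 Y) r + Y^2, which for r = n^2 is the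
    product of n^2 - X n - Y and n^2 + X n - Y. *)
Lemma rho_T0_lt1 k omega Cp Cs delta :
  (forall n : C, (n * n = Xc k omega Cp Cs delta * n + Yc k omega Cp Cs delta)%C ->
     Cmod n < 1) ->
  rho_T0 k omega Cp Cs delta < 1.
Proof.
intros H. unfold rho_T0.
set (X := Xc k omega Cp Cs delta) in *; set (Y := Yc k omega Cp Cs delta) in *.
assert (key : forall r s : C, (s * s = X ^ 2 * (X ^ 2 + 4 * Y))%C ->
   r = (X ^ 2 / 2 + Y + / 2 * s)%C -> Cmod r < 1).
{ intros r s Hs Hr.
  set (n := Csqrt r). assert (Hn := Csqrt_sqr r). fold n in Hn.
  assert (H2 : RtoC 2 <> 0%C) by (intros h; apply RtoC_inj in h; lra).
  assert (F : ((n * n - (X * n + Y)) * ((- n) * (- n) - (X * (- n) + Y)) = 0)%C).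
  { transitivity ((n * n) * (n * n) - (X ^ 2 + 2 * Y) * (n * n) + Y * Y)%C; [ring |].
    rewrite Hn, Hr.
    transitivity ((s * s - X ^ 2 * (X ^ 2 + 4 * Y)) / 4)%C.
    - field.
    - rewrite Hs. unfold Cdiv. ring. }
  assert (M : Cmod n < 1).
  { destruct (Ceq_dec (n * n - (X * n + Y))%C 0%C) as [e | e].
    - apply H. replace (n * n)%C with ((n * n - (X * n + Y)) + (X * n + Y))%C by ring.
      rewrite e; ring.
    - rewrite <- Cmod_opp. apply H.
      destruct (Ceq_dec (- n * - n - (X * - n + Y))%C 0%C) as [e' | e'].
      + replace (- n * - n)%C with ((- n * - n - (X * - n + Y)) + (X * - n + Y))%C by ring.
        rewrite e'; ring.
      + exfalso; revert F; apply Cmult_neq_0; assumption. }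
  rewrite <- Hn, Cmod_mult. assert (h := Cmod_ge_0 n). nra. }
assert (S := Csqrt_sqr (X ^ 2 * (X ^ 2 + 4 * Y))%C).
rewrite <- sqrt_1. apply sqrt_lt_1_alt. split.
- apply Rle_trans with (1 := Cmod_ge_0 _) (2 := Rmax_l _ _).
- apply Rmax_lub_lt.
  + apply (key _ _ S). reflexivity.
  + apply (key _ (- Csqrt (X ^ 2 * (X ^ 2 + 4 * Y)))%C).
    * rewrite <- S at 3. ring.
    * unfold r_minus. fold X Y. ring.
Qed.

(** With L = |a0|^2 - |a2|^2 and M = conj a0 a1 - a2 conj a1 the equation takes the
    form a0 n (L n + M) = - a2 (conj M n + L).  For |M| < L and |n| >= 1 one has
    |L n + M| >= |conj M n + L|, so the left side is larger than the right. *)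
Lemma schur_cohn (a0 a1 a2 n : C) :
  (a0 * n * n + a1 * n + a2 = 0)%C ->
  nsq a2 < nsq a0 ->
  nsq (Cconj a0 * a1 - a2 * Cconj a1)%C < (nsq a0 - nsq a2) ^ 2 ->
  Cmod n < 1.
Proof.
intros E L2 M2.
destruct (Rlt_le_dec (Cmod n) 1) as [h | h]; [exact h | exfalso].
set (M := (Cconj a0 * a1 - a2 * Cconj a1)%C) in *.
set (L := nsq a0 - nsq a2) in *.
assert (HL : 0 < L) by (unfold L; lra).
assert (nn : 1 <= nsq n) by (rewrite nsq_Cmod; nra).
assert (Eq : (a0 * n * (L * n + M) = - (a2 * (Cconj M * n + L)))%C).
{ assert (LE : RtoC L = (a0 * Cconj a0 - a2 * Cconj a2)%C).
  { unfold L; rewrite !nsq_Cmod, RtoC_minus, !Cmod2_conj; reflexivity. }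
  assert (Z : (a0 * n * (L * n + M) + a2 * (Cconj M * n + L)
     = L * (a0 * n * n + a1 * n + a2))%C).
  { unfold M. rewrite LE. destruct a0, a1, a2, n.
    apply injective_projections; simpl; ring. }
  rewrite E, Cmult_0_r in Z.
  replace (a0 * n * (L * n + M))%C
    with ((a0 * n * (L * n + M) + a2 * (Cconj M * n + L)) - a2 * (Cconj M * n + L))%C by ring.
  rewrite Z; ring. }
assert (Mul : forall x y : C, nsq (x * y)%C = nsq x * nsq y).
{ intros x y; unfold nsq; destruct x, y; simpl; ring. }
assert (Q : nsq a0 * nsq n * nsq (L * n + M)%C = nsq a2 * nsq (Cconj M * n + L)%C).
{ rewrite <- !Mul, Eq. unfold nsq; simpl; ring. }
assert (D : nsq (L * n + M)%C - nsq (Cconj M * n + L)%C = (L ^ 2 - nsq M) * (nsq n - 1)).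
{ unfold nsq; destruct M, n; simpl; ring. }
assert (p2 : 0 <= nsq a2) by (rewrite nsq_Cmod; apply pow2_ge_0).
assert (pc : 0 <= nsq (Cconj M * n + L)%C) by (rewrite nsq_Cmod; apply pow2_ge_0).
assert (pd : 0 <= (L ^ 2 - nsq M) * (nsq n - 1)) by (apply Rmult_le_pos; lra).
assert (pp : 0 < nsq (L * n + M)%C).
{ assert (T := Cmod_triangle (L * n + M) (- M)).
  replace (L * n + M + - M)%C with (L * n)%C in T by ring.
  rewrite Cmod_mult, Cmod_R, Rabs_right, Cmod_opp in T by lra.
  rewrite nsq_Cmod in M2. rewrite nsq_Cmod.
  assert (Cmod M < L) by (assert (g := Cmod_ge_0 M); nra).
  assert (0 < Cmod (L * n + M)) by nra. nra. }
assert (nsq a2 * nsq (Cconj M * n + L)%C <= nsq a2 * nsq (L * n + M)%C)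
  by (apply Rmult_le_compat_l; lra).
assert (nsq a2 * nsq (L * n + M)%C < nsq a0 * nsq n * nsq (L * n + M)%C)
  by (apply Rmult_lt_compat_r; nra).
lra.
Qed.

Lemma rho_lt1_of_mode_form (sg Cs c k delta : R) (l1 l2 : C) :
  0 < sg -> 0 < Cs -> 0 < c ->
  Csqrt (RtoC (sg ^ 2 * (k ^ 2 - 1))) = (sg * l1)%C ->
  Csqrt (RtoC (sg ^ 2 * (k ^ 2 - 1 / c ^ 2))) = (sg * l2)%C ->
  mode_den (stiffP c (k ^ 2)) (stiffQ c (k ^ 2)) c l1 l2 <> 0%C ->
  (forall n, mode_form (stiffP c (k ^ 2)) (stiffQ c (k ^ 2)) c l1 l2
     (Cexp (- (sg * l1) * delta)) (Cexp (- (sg * l2) * delta)) n = 0%C -> Cmod n < 1) ->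
  rho_T0 (sg * k) (sg * Cs) (c * Cs) Cs delta < 1.
Proof.
intros Hs HCs Hc E1 E2 HD HF.
apply rho_T0_lt1. intros n Hn. apply HF.
apply (mode_eq_of_root sg Cs c k l1 l2 _ _ n delta); try assumption; try reflexivity.
- unfold lambda1. rewrite <- E1. do 2 f_equal. field. lra.
- unfold lambda2. rewrite <- E2. do 2 f_equal. field. lra.
- assert (S := Csqrt_sqr (RtoC (sg ^ 2 * (k ^ 2 - 1)))).
  rewrite E1, RtoC_mult, RtoC_pow in S.
  assert (sC : RtoC sg <> 0%C) by (intros h; apply RtoC_inj in h; lra).
  replace (l1 * l1)%C with (((sg * l1) * (sg * l1)) / (sg * sg))%C by (field; assumption).
  rewrite S. field. assumption.
Qed.

Lemma Csqrt_scaled_pos (sg v : R) : 0 < sg -> 0 <= v ->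
  Csqrt (RtoC (sg ^ 2 * v)) = (sg * RtoC (sqrt v))%C.
Proof.
intros hs hv. assert (0 <= sg ^ 2) by apply pow2_ge_0.
rewrite Csqrt_RtoC_ge0 by (apply Rmult_le_pos; assumption).
rewrite sqrt_mult, sqrt_pow2, RtoC_mult by lra. reflexivity.
Qed.

Lemma Csqrt_scaled_neg (sg v : R) : 0 < sg -> v < 0 ->
  Csqrt (RtoC (sg ^ 2 * v)) = (sg * (0, sqrt (- v)))%C.
Proof.
intros hs hv. assert (0 < sg ^ 2) by (apply pow_lt; assumption).
rewrite Csqrt_RtoC_lt0 by nra.
replace (- (sg ^ 2 * v)) with (sg ^ 2 * - v) by ring.
rewrite sqrt_mult, sqrt_pow2 by lra.
apply injective_projections; simpl; ring.
Qed.

Lemma Cexp_evanescent (sg l delta : R) : Cexp (- (sg * RtoC l) * delta) = RtoC (exp (- l * (sg * delta))).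
Proof.
unfold Cexp; apply injective_projections; simpl;
  replace (- (sg * l - 0 * 0) * delta - - (sg * 0 + 0 * l) * 0) with (- l * (sg * delta)) by ring;
  replace (- (sg * l - 0 * 0) * 0 + - (sg * 0 + 0 * l) * delta) with 0 by ring;
  rewrite ?cos_0, ?sin_0; ring.
Qed.

Lemma Cexp_propagating (sg a delta : R) : Cexp (- (sg * (0, a)) * delta)
  = (cos (a * (sg * delta)), - sin (a * (sg * delta))).
Proof.
unfold Cexp; apply injective_projections; simpl;
  replace (- (sg * 0 - 0 * a) * delta - - (sg * a + 0 * 0) * 0) with 0 by ring;
  replace (- (sg * 0 - 0 * a) * 0 + - (sg * a + 0 * 0) * delta) with (- (a * (sg * delta))) by ring;
  rewrite exp_0, ?cos_neg, ?sin_neg; ring.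
Qed.

Lemma stiffP_pos c x : 0 < c -> 0 <= x -> 0 < stiffP c x.
Proof.
intros hc hx. unfold stiffP. assert (0 <= (2 * x - 1) ^ 2) by apply pow2_ge_0.
destruct (Req_dec x 0) as [e | e]; [subst; lra |].
assert (0 < c * x) by (apply Rmult_lt_0_compat; lra). lra.
Qed.

Lemma stiffQ_pos c x : 0 < c -> 0 <= x -> 0 < stiffQ c x.
Proof. intros; unfold stiffQ; lra. Qed.

Lemma coupling_sqr c k : stiffP c (k ^ 2) * stiffQ c (k ^ 2) - c = (k * (4 * k ^ 2 + c - 2)) ^ 2.
Proof. unfold stiffP, stiffQ; ring. Qed.

Lemma Re_mode_den_propagating (P Q c a b : R) :
  Re (mode_den P Q c (0, a) (0, b)) = P + Q * a * b + (a + c * b).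
Proof. unfold mode_den; simpl; ring. Qed.

Lemma Re_mode_den_mixed (P Q c a b : R) : Re (mode_den P Q c (0, a) b) = P + a.
Proof. unfold mode_den; simpl; ring. Qed.

Lemma Im_mode_den_evanescent (P Q c l1 l2 : R) :
  Im (mode_den P Q c l1 l2) = - (l1 + c * l2).
Proof. unfold mode_den; simpl; ring. Qed.

(** * Both waves propagating *)

(** Put p_j = n - e_j and q_j = n + e_j.  The equation reads
    q_2 (P p_1 + a q_1) = - b p_2 (Q a q_1 + c p_1).  If |n| >= 1, then
    Re (p_j conj q_j) = |n|^2 - 1 >= 0, so the two brackets enclose an acute angle
    while - p_2 and q_2 do not. *)
Lemma root_lt1_both_propagating (P Q c a b : R) (e1 e2 n : C) :
  0 < P -> 0 < Q -> 0 < c -> 0 < a -> 0 < b ->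
  nsq e1 = 1 -> nsq e2 = 1 ->
  mode_form P Q c (0, a) (0, b) e1 e2 n = 0%C -> Cmod n < 1.
Proof.
intros HP HQ Hc Ha Hb N1 N2 E.
destruct (Rlt_le_dec (Cmod n) 1) as [h | h]; [exact h | exfalso].
assert (nn : 1 <= nsq n) by (rewrite nsq_Cmod; nra).
set (p1 := (n - e1)%C) in *; set (q1 := (n + e1)%C) in *.
set (p2 := (n - e2)%C) in *; set (q2 := (n + e2)%C) in *.
set (W1 := (P * p1 + a * q1)%C); set (W2 := ((Q * a)%R * q1 + c * p1)%C).
assert (Eq : (q2 * W1 + b * p2 * W2 = 0)%C).
{ rewrite <- E. unfold W1, W2, mode_form. fold p1 q1 p2 q2.
  destruct p1, q1, p2, q2; apply injective_projections; simpl; ring. }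
assert (R1 : 0 <= Re p1 * Re q1 + Im p1 * Im q1).
{ replace (Re p1 * Re q1 + Im p1 * Im q1) with (nsq n - nsq e1); [lra |].
  unfold p1, q1, nsq; destruct n, e1; simpl; ring. }
assert (R2 : 0 <= Re p2 * Re q2 + Im p2 * Im q2).
{ replace (Re p2 * Re q2 + Im p2 * Im q2) with (nsq n - nsq e2); [lra |].
  unfold p2, q2, nsq; destruct n, e2; simpl; ring. }
assert (S1 : nsq p1 + nsq q1 = 2 * (nsq n + nsq e1)).
{ unfold p1, q1, nsq; destruct n, e1; simpl; ring. }
assert (S2 : nsq p2 + nsq q2 = 2 * (nsq n + nsq e2)).
{ unfold p2, q2, nsq; destruct n, e2; simpl; ring. }
assert (pos : forall z, 0 <= nsq z) by (intros z; rewrite nsq_Cmod; apply pow2_ge_0).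
set (I := Re W1 * Re W2 + Im W1 * Im W2).
assert (PI : 0 < I).
{ replace I with (P * c * nsq p1 + Q * a ^ 2 * nsq q1
     + (P * Q * a + a * c) * (Re p1 * Re q1 + Im p1 * Im q1)).
  2: { unfold I, W1, W2, nsq; destruct p1, q1; simpl; ring. }
  assert (0 < P * c) by (apply Rmult_lt_0_compat; assumption).
  assert (0 < Q * a ^ 2) by (apply Rmult_lt_0_compat; [| apply pow_lt]; assumption).
  assert (0 < P * Q * a + a * c).
  { apply Rplus_lt_0_compat; repeat apply Rmult_lt_0_compat; assumption. }
  assert (G1 := pos p1); assert (G2 := pos q1).
  assert (0 <= (P * Q * a + a * c) * (Re p1 * Re q1 + Im p1 * Im q1))
    by (apply Rmult_le_pos; lra).
  destruct (Req_dec (nsq p1) 0) as [z | z]; nra. }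
assert (B : nsq q2 * I + b * nsq W2 * (Re p2 * Re q2 + Im p2 * Im q2) = 0).
{ assert (X : Re ((q2 * W1 + b * p2 * W2) * (Cconj q2 * Cconj W2))%C = 0)
    by (rewrite Eq, Cmult_0_l; reflexivity).
  rewrite <- X. unfold I, nsq; destruct q2, W1, p2, W2; simpl; ring. }
assert (b2 : 0 <= b * nsq W2 * (Re p2 * Re q2 + Im p2 * Im q2)).
{ apply Rmult_le_pos; [apply Rmult_le_pos; [lra | apply pos] | exact R2]. }
assert (z2 : nsq q2 = 0) by (assert (g := pos q2); nra).
assert (P2 : nsq p2 <> 0) by lra.
assert (Wz : b ^ 2 * (nsq p2 * nsq W2) = nsq q2 * nsq W1).
{ assert (X : (b * p2 * W2 = - (q2 * W1))%C).
  { replace (b * p2 * W2)%C with ((q2 * W1 + b * p2 * W2) - q2 * W1)%C by ring.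
    rewrite Eq; ring. }
  transitivity (nsq (b * p2 * W2)%C); [| rewrite X];
  unfold nsq; destruct p2, q2, W1, W2; simpl; ring. }
rewrite z2, Rmult_0_l in Wz.
assert (W0 : nsq W2 = 0).
{ destruct (Rmult_integral _ _ Wz) as [k | k].
  - exfalso; assert (0 < b ^ 2) by (apply pow_lt; lra); lra.
  - destruct (Rmult_integral _ _ k); [contradiction | assumption]. }
assert (Re W2 = 0 /\ Im W2 = 0) as [w1 w2] by (unfold nsq in W0; split; nra).
unfold I in PI; rewrite w1, w2 in PI; lra.
Qed.

Lemma rho_lt1_both_propagating (sg Cs c k delta : R) :
  0 < sg -> 0 < Cs -> 0 < c -> k ^ 2 < 1 / c ^ 2 -> 1 / c ^ 2 < 1 ->
  rho_T0 (sg * k) (sg * Cs) (c * Cs) Cs delta < 1.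
Proof.
intros hs hC hc hk ht.
assert (P0 := stiffP_pos c (k ^ 2) hc (pow2_ge_0 k)).
assert (Q0 := stiffQ_pos c (k ^ 2) hc (pow2_ge_0 k)).
set (a := sqrt (- (k ^ 2 - 1))). set (b := sqrt (- (k ^ 2 - 1 / c ^ 2))).
assert (a0 : 0 < a) by (apply sqrt_lt_R0; lra).
assert (b0 : 0 < b) by (apply sqrt_lt_R0; lra).
apply (rho_lt1_of_mode_form sg Cs c k delta (0, a) (0, b)); try assumption.
- apply Csqrt_scaled_neg; lra.
- apply Csqrt_scaled_neg; lra.
- intros h. apply (f_equal Re) in h. rewrite Re_mode_den_propagating in h.
  assert (0 < stiffQ c (k ^ 2) * a * b) by (repeat apply Rmult_lt_0_compat; assumption).
  assert (0 < c * b) by (apply Rmult_lt_0_compat; assumption). change (Re 0%C) with 0 in h; lra.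
- intros n. rewrite !Cexp_propagating.
  assert (N : forall v, nsq (cos v, - sin v) = 1).
  { intros v. assert (h := sin2_cos2 v). unfold Rsqr in h. unfold nsq; simpl; lra. }
  apply root_lt1_both_propagating; try assumption; apply N.
Qed.

(** * Positivity certificates for polynomials *)

(** A homogeneous form, encoded by its coefficients in increasing order of the
    exponent of x. *)
Fixpoint hform (l : list Z) (x y : R) : R :=
  match l with
  | [] => 0
  | a :: l' => IZR a * y ^ length l' + x * hform l' x y
  end.

(** Certificates of positivity on an interval: a polynomial in t on [0, q / r] is
    rewritten as a form in t and q - r t, a polynomial in c on [7 / 5, oo) as a
    form in 5 c - 7 and 1.  The integer coefficients below are the result of this
    change of basis, after clearing the denominator K. *)
Lemma hform_nonneg (l : list Z) (x y K p : R) :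
  forallb (Z.leb 0) l = true -> 0 <= x -> 0 <= y -> 0 < K ->
  K * p = hform l x y -> 0 <= p.
Proof.
intros Hl Hx Hy HK E.
assert (h : 0 <= hform l x y).
{ clear E; induction l as [| a l IH]; simpl in *; [lra |].
  apply andb_prop in Hl as [Ha Hl]. apply Z.leb_le, IZR_le in Ha.
  apply Rplus_le_le_0_compat; apply Rmult_le_pos;
    [lra | apply pow_le; lra | lra | apply IH; assumption]. }
destruct (Rle_lt_dec 0 p); [assumption | nra].
Qed.

(** * One wave propagating, one evanescent *)

(** The difference of the two sides of the Schur-Cohn condition, up to a positive
    factor, for l1 = i a and l2 = b: sh and ch are the hyperbolic functions of
    b d, and co and si the trigonometric functions of a d. *)
Definition mixed_gap (P Q c a b sh ch co si : R) : R :=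
  let W := P + b ^ 2 * Q * c in
  let U := P - b ^ 2 * Q * c in
  let V := b * (P * Q + c) in
  let kap := b * (P * Q - c) in
  let n1 := P ^ 2 + b ^ 2 * c ^ 2 in
  let n2 := a ^ 2 * (1 + b ^ 2 * Q ^ 2) in
  2 * a * (W ^ 2 * sh ^ 2 - kap ^ 2) + W * (n1 + n2) * sh * ch
  + (n1 - n2) * sh * (U * co - V * si) + 2 * a * kap * ch * (V * co + U * si).

Lemma root_lt1_mixed (P Q c a b e2 co si : R) (n : C) :
  0 < P -> 0 < Q -> 0 < c -> 0 < a -> 0 < b -> 0 < e2 < 1 -> co ^ 2 + si ^ 2 = 1 ->
  0 < mixed_gap P Q c a b ((/ e2 - e2) / 2) ((/ e2 + e2) / 2) co si ->
  mode_form P Q c (0, a) b (co, - si) e2 n = 0%C -> Cmod n < 1.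
Proof.
intros HP HQ Hc Ha Hb He Hcs HF E.
set (G := (P + a, - (b * (Q * a + c))) : C).
set (H := (P - a, - (b * (Q * a - c))) : C).
assert (d : nsq G - nsq H = 4 * a * (P + b ^ 2 * Q * c)).
{ unfold G, H, nsq; simpl; ring. }
assert (dp : 0 < 4 * a * (P + b ^ 2 * Q * c)).
{ assert (0 < b ^ 2 * Q * c).
  { repeat apply Rmult_lt_0_compat; try assumption. lra. }
  apply Rmult_lt_0_compat; lra. }
assert (Hn : 0 <= nsq H) by (rewrite nsq_Cmod; apply pow2_ge_0).
set (e1 := (co, - si) : C) in *.
assert (N2 : nsq (- (e1 * e2 * H))%C = e2 ^ 2 * nsq H).
{ transitivity ((co ^ 2 + si ^ 2) * (e2 ^ 2 * nsq H)); [| rewrite Hcs; ring].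
  unfold e1, H, nsq; simpl; ring. }
assert (He2 : 0 < e2 ^ 2 < 1) by nra.
apply (schur_cohn G (- (e1 * Cconj H - e2 * Cconj G)) (- (e1 * e2 * H)) n).
- rewrite <- E. unfold mode_form, G, H, e1.
  destruct n; apply injective_projections; simpl; ring.
- rewrite N2. nra.
- rewrite N2.
  assert (EM : (Cconj G * - (e1 * Cconj H - e2 * Cconj G)
      - - (e1 * e2 * H) * Cconj (- (e1 * Cconj H - e2 * Cconj G)))%C
    = (- e1 * Cconj G * Cconj H + e2 * (Cconj G * Cconj G)
       - RtoC (co ^ 2 + si ^ 2) * (e2 * (H * H)) + e1 * e2 ^ 2 * G * H)%C).
  { unfold G, H, e1; apply injective_projections; simpl; ring. }
  rewrite EM, Hcs.
  set (K := (- Cconj G * Cconj H + e2 ^ 2 * G * H)%C).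
  match goal with |- nsq ?M < ?L =>
    assert (I : L - nsq M = 16 * a * e2 ^ 2 *
      mixed_gap P Q c a b ((/ e2 - e2) / 2) ((/ e2 + e2) / 2) co si
      + (1 - (co ^ 2 + si ^ 2)) * nsq K) end.
  { unfold K, mixed_gap, G, H, e1, nsq; simpl. field. lra. }
  rewrite Hcs in I.
  assert (0 < 16 * a * e2 ^ 2 *
      mixed_gap P Q c a b ((/ e2 - e2) / 2) ((/ e2 + e2) / 2) co si).
  { apply Rmult_lt_0_compat; [apply Rmult_lt_0_compat; lra | exact HF]. }
  lra.
Qed.

(** In the application sh and ch are taken at b d, phi is a d, De is the argument of (P - i b c)(1 + i b Q) and
    phi + 2 al - De the phase of the oscillating term.  If cos De ch > 1, the
    term with the phase is at most (n1 + n2) sh in absolute value, whatever the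
    phase, and is dominated.  Otherwise sh is at most tan De and phi at most 1.
    As long as the phase stays below PI - De its sine is at least sin De, and all
    terms add up to something positive.  Beyond that point the excess psi is
    bounded by phi <= (a / b) sh, which costs only terms of the order of those that
    help. *)
Lemma phase_gap_pos (n1 n2 g a b sh ch phi al De : R) :
  0 < n1 -> 0 < n2 -> 0 < g -> g ^ 2 = n1 * n2 ->
  0 < sh -> 1 < ch -> ch ^ 2 = 1 + sh ^ 2 -> 0 < a -> 0 < b ->
  0 <= De < PI / 2 -> De <= al <= PI / 2 ->
  0 <= phi -> b * phi <= a * sh -> b ^ 2 * phi ^ 2 / 2 <= a ^ 2 * (ch - 1) ->
  a * sin De <= b * cos De -> a * g * sin De <= b * n2 -> 11 / 20 <= cos De ->
  0 < 2 * g * ((cos De * ch) ^ 2 - 1) + (n1 + n2) * (cos De * ch) * sh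
      + (n1 - n2) * sh * cos (phi + (2 * al - De))
      + 2 * g * sin De * ch * sin (phi + (2 * al - De)).
Proof.
intros Hn1 Hn2 Hg Hgg Hsh Hch Hcs Ha Hb HD Hal Hphi F1 F2 P1 P3 P2.
assert (pi := PI_RGT_0).
assert (sD : 0 <= sin De) by (apply sin_ge_0; lra).
assert (cD : 0 < cos De) by (apply cos_gt_0; lra).
assert (tD : sin De ^ 2 + cos De ^ 2 = 1).
{ assert (h := sin2_cos2 De). unfold Rsqr in h. lra. }
set (y := cos De * ch).
assert (y0 : 0 < y) by (apply Rmult_lt_0_compat; lra).
destruct (Rlt_le_dec 1 y) as [hy | hy].
- set (Ag := phi + (2 * al - De)).
  assert (tA : sin Ag ^ 2 + cos Ag ^ 2 = 1).
  { assert (h := sin2_cos2 Ag). unfold Rsqr in h. lra. }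
  set (u := (n1 - n2) * sh * cos Ag + 2 * g * sin De * ch * sin Ag).
  (* Cauchy-Schwarz; for cos De ch = 1 this is an equality at the worst phase. *)
  assert (u2 : u ^ 2 <= ((n1 + n2) * sh) ^ 2).
  { assert (cs : u ^ 2 <= ((n1 - n2) * sh) ^ 2 + (2 * g * sin De * ch) ^ 2).
    { replace (((n1 - n2) * sh) ^ 2 + (2 * g * sin De * ch) ^ 2)
        with ((((n1 - n2) * sh) ^ 2 + (2 * g * sin De * ch) ^ 2)
              * (sin Ag ^ 2 + cos Ag ^ 2)) by (rewrite tA; ring).
      assert (0 <= ((n1 - n2) * sh * sin Ag - 2 * g * sin De * ch * cos Ag) ^ 2)
        by apply pow2_ge_0.
      unfold u; nra. }
    assert (e : (2 * g * sin De * ch) ^ 2 = 4 * (n1 * n2) * (ch ^ 2 - y ^ 2)).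
    { rewrite <- Hgg. unfold y. replace (ch ^ 2 - (cos De * ch) ^ 2)
        with (ch ^ 2 * (1 - cos De ^ 2)) by ring.
      replace (1 - cos De ^ 2) with (sin De ^ 2) by lra. ring. }
    assert (y2 : 1 <= y ^ 2) by nra.
    assert (0 < n1 * n2) by (apply Rmult_lt_0_compat; lra).
    assert (4 * (n1 * n2) * (ch ^ 2 - y ^ 2) <= 4 * (n1 * n2) * sh ^ 2)
      by (apply Rmult_le_compat_l; lra).
    nra. }
  assert (N : 0 < (n1 + n2) * sh) by (apply Rmult_lt_0_compat; lra).
  assert (ul : - ((n1 + n2) * sh) <= u).
  { destruct (Rle_lt_dec (- ((n1 + n2) * sh)) u); [assumption | nra]. }
  assert (0 < (n1 + n2) * sh * (y - 1)) by (apply Rmult_lt_0_compat; lra).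
  assert (0 < 2 * g * (y ^ 2 - 1)) by (apply Rmult_lt_0_compat; nra).
  unfold u in ul. nra.
- assert (key : 0 < g * (ch - 1)) by (apply Rmult_lt_0_compat; lra).
  assert (st : cos De * sh <= sin De).
  { assert ((cos De * sh) ^ 2 <= sin De ^ 2).
    { replace ((cos De * sh) ^ 2) with (y ^ 2 - cos De ^ 2)
        by (unfold y; replace ((cos De * ch) ^ 2) with (cos De ^ 2 * ch ^ 2) by ring;
            rewrite Hcs; ring).
      nra. }
    assert (0 < cos De * sh) by (apply Rmult_lt_0_compat; lra). nra. }
  assert (phi1 : phi <= 1).
  { assert (b * phi * cos De <= a * sh * cos De) by (apply Rmult_le_compat_r; lra).
    assert (a * (cos De * sh) <= a * sin De) by (apply Rmult_le_compat_l; lra).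
    assert (b * cos De * phi <= b * cos De * 1) by lra.
    assert (0 < b * cos De) by (apply Rmult_lt_0_compat; lra).
    apply (Rmult_le_reg_l (b * cos De)); assumption. }
  assert (pi3 := PI2_1).
  destruct (Rle_lt_dec (phi + 2 * al) PI) as [hA | hA].
  + set (Ag := phi + (2 * al - De)).
    assert (sA : sin De <= sin Ag).
    { destruct (Rle_lt_dec Ag (PI / 2)) as [h | h].
      - apply sin_incr_1; unfold Ag in *; lra.
      - rewrite <- (sin_PI_x Ag). apply sin_incr_1; unfold Ag in *; lra. }
    assert (cA : - cos De <= cos Ag).
    { replace (- cos De) with (cos (PI - De)).
      - apply cos_decr_1; unfold Ag in *; lra.
      - rewrite cos_minus, cos_PI, sin_PI; ring. }
    assert (cB : cos Ag <= cos De) by (apply cos_decr_1; unfold Ag in *; lra).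
    assert (t1 : 2 * g * sin De * ch * sin De <= 2 * g * sin De * ch * sin Ag).
    { apply Rmult_le_compat_l; [| exact sA].
      repeat apply Rmult_le_pos; lra. }
    assert (t2 : 0 <= sh * ((n1 + n2) * (cos De * ch) + (n1 - n2) * cos Ag)).
    { apply Rmult_le_pos; [lra |].
      assert (cos De <= cos De * ch) by nra.
      assert ((n1 + n2) * cos De <= (n1 + n2) * (cos De * ch))
        by (apply Rmult_le_compat_l; lra).
      destruct (Rle_lt_dec n2 n1); nra. }
    assert (t3 : 2 * g * (y ^ 2 - 1) + 2 * g * sin De * ch * sin De
       = 2 * (g * (ch - 1)) * (cos De ^ 2 * ch + 1)).
    { unfold y. replace (2 * g * sin De * ch * sin De)
        with (2 * g * ch * (sin De ^ 2)) by ring.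
      replace (sin De ^ 2) with (1 - cos De ^ 2) by lra. ring. }
    assert (t4 : 0 < 2 * (g * (ch - 1)) * (cos De ^ 2 * ch + 1)).
    { apply Rmult_lt_0_compat; [lra |].
      assert (0 <= cos De ^ 2) by apply pow2_ge_0. nra. }
    unfold y in *. nra.
  + set (psi := phi + 2 * al - PI).
    assert (hp : 0 < psi <= phi) by (unfold psi; lra).
    replace (phi + (2 * al - De)) with (PI - (De - psi)) by (unfold psi; ring).
    rewrite sin_PI_x. replace (cos (PI - (De - psi))) with (- cos (De - psi))
      by (rewrite (cos_minus PI), cos_PI, sin_PI; ring).
    assert (c0 : 0 <= cos (De - psi)) by (apply cos_ge_0; lra).
    assert (sp0 : 0 <= sin psi) by (apply sin_ge_0; lra).
    assert (sp1 : sin psi < psi) by (apply sin_lt_x; lra).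
    assert (cp1 := COS_bound psi).
    assert (cp2 : 1 - cos psi <= phi ^ 2 / 2).
    { replace psi with (2 * (psi / 2)) by field. rewrite cos_2a_sin.
      assert (sin (psi / 2) < psi / 2) by (apply sin_lt_x; lra).
      assert (0 <= sin (psi / 2)) by (apply sin_ge_0; lra).
      nra. }
    (* a tan De <= b turns the bounds of psi by phi into bounds without a and b. *)
    assert (k1 : sin psi * sin De <= cos De * sh).
    { apply (Rmult_le_reg_l b); [assumption |].
      assert (b * sin psi <= a * sh) by nra.
      assert (b * sin psi * sin De <= a * sh * sin De) by (apply Rmult_le_compat_r; lra).
      assert (sh * (a * sin De) <= sh * (b * cos De)) by (apply Rmult_le_compat_l; lra).
      lra. }
    assert (k2 : sin De ^ 2 * (1 - cos psi) <= cos De ^ 2 * (ch - 1)).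
    { apply (Rmult_le_reg_l (b ^ 2)); [apply pow_lt; assumption |].
      assert (b ^ 2 * (1 - cos psi) <= a ^ 2 * (ch - 1)).
      { assert (0 < b ^ 2) by (apply pow_lt; assumption). nra. }
      assert (sin De ^ 2 * (b ^ 2 * (1 - cos psi)) <= sin De ^ 2 * (a ^ 2 * (ch - 1)))
        by (apply Rmult_le_compat_l; [apply pow2_ge_0 | assumption]).
      assert ((a * sin De) ^ 2 <= (b * cos De) ^ 2).
      { apply pow_incr; split; [apply Rmult_le_pos |]; lra. }
      assert ((ch - 1) * (a * sin De) ^ 2 <= (ch - 1) * (b * cos De) ^ 2)
        by (apply Rmult_le_compat_l; lra).
      nra. }
    assert (core : g * (ch - 1) <= g * (y ^ 2 - 1)
        + g * sin De * ch * sin (De - psi) + g * ch * cos De * (sin psi * sin De)).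
    { rewrite sin_minus.
      assert (E : g * (y ^ 2 - 1) + g * sin De * ch * (sin De * cos psi - cos De * sin psi)
         + g * ch * cos De * (sin psi * sin De)
         = g * (y ^ 2 - 1 + ch * sin De ^ 2 - ch * (sin De ^ 2 * (1 - cos psi)))) by ring.
      rewrite E. apply Rmult_le_compat_l; [lra |].
      assert (ch * (sin De ^ 2 * (1 - cos psi)) <= ch * (cos De ^ 2 * (ch - 1)))
        by (apply Rmult_le_compat_l; lra).
      assert (ch * sin De ^ 2 = ch - ch * cos De ^ 2).
      { replace (sin De ^ 2) with (1 - cos De ^ 2) by lra. ring. }
      unfold y. lra. }
    destruct (Rle_lt_dec n1 n2) as [hn | hn].
    * assert (ng : 2 * g <= n1 + n2).
      { assert (0 <= (n1 - n2) ^ 2) by apply pow2_ge_0. nra. }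
      assert (0 <= (n2 - n1) * sh * cos (De - psi)).
      { apply Rmult_le_pos; [apply Rmult_le_pos |]; lra. }
      assert (2 * g * (y * sh) <= (n1 + n2) * (y * sh)).
      { apply Rmult_le_compat_r; [apply Rmult_le_pos |]; lra. }
      assert (g * ch * cos De * (sin psi * sin De) <= g * ch * cos De * (cos De * sh)).
      { apply Rmult_le_compat_l; [| lra]. repeat apply Rmult_le_pos; lra. }
      assert (g * ch * cos De * (cos De * sh) <= g * (y * sh)).
      { unfold y. assert (cos De <= 1) by (assert (h := COS_bound De); lra).
        assert (0 <= g * ch * cos De * sh * (1 - cos De)).
        { repeat apply Rmult_le_pos; lra. } nra. }
      fold y. nra.
    * assert (k3 : g * (sin psi * sin De) <= n2 * sh).
      { apply (Rmult_le_reg_l b); [assumption |].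
        assert (b * sin psi <= a * sh) by nra.
        assert (b * sin psi * (g * sin De) <= a * sh * (g * sin De))
          by (apply Rmult_le_compat_r; [apply Rmult_le_pos |]; lra).
        assert (sh * (a * g * sin De) <= sh * (b * n2)) by (apply Rmult_le_compat_l; lra).
        lra. }
      assert (gn : n2 < g) by nra.
      (* For z = cos De and ch = 1 / z this is 1 <= z + z^2 + z^3, hence the bound 11 / 20. *)
      assert (hc : ch - 1 <= sh * cos De).
      { assert ((ch - 1) ^ 2 <= (sh * cos De) ^ 2).
        { replace ((sh * cos De) ^ 2) with ((ch - 1) * ((ch + 1) * cos De ^ 2))
            by (replace ((sh * cos De) ^ 2) with (sh ^ 2 * cos De ^ 2) by ring;
                replace (sh ^ 2) with (ch ^ 2 - 1) by (rewrite Hcs; ring); ring).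
          replace ((ch - 1) ^ 2) with ((ch - 1) * (ch - 1)) by ring.
          apply Rmult_le_compat_l; [lra |].
          assert (cos De <= 1) by (assert (h := COS_bound De); lra).
          set (z := cos De) in *.
          assert (z * (ch * (1 - z ^ 2)) <= z * (1 + z ^ 2)).
          { assert (0 <= (1 - z ^ 2) * (1 - y)) by (apply Rmult_le_pos; nra).
            assert (1 - z ^ 2 <= z + z ^ 3) by (simpl; nra).
            unfold y in *. nra. }
          assert (ch * (1 - z ^ 2) <= 1 + z ^ 2) by (apply (Rmult_le_reg_l z); lra).
          clear - H1. lra. }
        assert (0 < sh * cos De) by (apply Rmult_lt_0_compat; lra). nra. }
      assert (c2 : cos (De - psi) <= cos De + sin psi * sin De).
      { rewrite cos_minus. nra. }
      assert (e3 : (n1 - n2) * sh * cos (De - psi)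
          <= (n1 - n2) * sh * (cos De + sin psi * sin De)).
      { apply Rmult_le_compat_l; [apply Rmult_le_pos |]; lra. }
      assert (e4 : 2 * (ch * cos De) * (g * (sin psi * sin De))
          <= 2 * (ch * cos De) * (n2 * sh)).
      { apply Rmult_le_compat_l; [| lra].
        repeat apply Rmult_le_pos; lra. }
      set (f := 2 * g * ((cos De * ch) ^ 2 - 1) + (n1 + n2) * (cos De * ch) * sh
        + (n1 - n2) * sh * - cos (De - psi) + 2 * g * sin De * ch * sin (De - psi)).
      assert (f1 : 2 * (g * (ch - 1)) + (n1 - n2) * sh * cos De * (ch - 1)
          - (n1 - n2) * sh * (sin psi * sin De) <= f).
      { unfold f; unfold y in core; clear - core e4 e3; lra. }
      assert (f2 : (n1 - n2) * sh * (g * (sin psi * sin De)) <= (n1 - n2) * sh * (n2 * sh)).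
      { apply Rmult_le_compat_l; [apply Rmult_le_pos |]; lra. }
      assert (f3 : (n1 - n2) * (ch - 1) * (n2 * (ch - 1))
         <= (n1 - n2) * (ch - 1) * (g * (sh * cos De))).
      { apply Rmult_le_compat_l; [apply Rmult_le_pos; lra |].
        apply Rmult_le_compat; lra. }
      assert (f4 : 0 < (ch - 1) * (n2 * n2)).
      { repeat apply Rmult_lt_0_compat; lra. }
      assert (f5 : 0 < g * f).
      { apply Rlt_le_trans with (g * (2 * (g * (ch - 1)) + (n1 - n2) * sh * cos De * (ch - 1)
          - (n1 - n2) * sh * (sin psi * sin De))); [| apply Rmult_le_compat_l; lra].
        replace (g * (2 * (g * (ch - 1)) + (n1 - n2) * sh * cos De * (ch - 1)
          - (n1 - n2) * sh * (sin psi * sin De)))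
          with (2 * g ^ 2 * (ch - 1) + (n1 - n2) * (ch - 1) * (g * (sh * cos De))
             - (n1 - n2) * sh * (g * (sin psi * sin De))) by ring.
        rewrite Hgg.
        assert (s2 : (n1 - n2) * sh * (n2 * sh)
            = (n1 - n2) * n2 * ((ch - 1) * (ch + 1))).
        { replace ((ch - 1) * (ch + 1)) with (ch ^ 2 - 1) by ring. rewrite Hcs; ring. }
        lra. }
      change (0 < f). apply (Rmult_lt_reg_l g); [assumption |]. lra.
Qed.

Lemma cosh_ge_quadratic x : 1 + x ^ 2 / 2 <= cosh x.
Proof.
assert (h : forall v, 0 < v -> 1 + v ^ 2 / 2 < cosh v).
{ intros v hv.
  assert (E : cosh v = 1 + 2 * sinh (v / 2) ^ 2).
  { assert (q := cosh_sqr (v / 2)).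
    replace (1 + 2 * sinh (v / 2) ^ 2) with (cosh (v / 2) ^ 2 + sinh (v / 2) ^ 2) by lra.
    unfold cosh, sinh. replace (exp v) with (exp (v / 2) * exp (v / 2))
      by (rewrite <- exp_plus; f_equal; field).
    replace (exp (- v)) with (exp (- (v / 2)) * exp (- (v / 2)))
      by (rewrite <- exp_plus; f_equal; field). field. }
  rewrite E. assert (s := sinh_gt_id (v / 2) ltac:(lra)). nra. }
assert (c : cosh (- x) = cosh x) by (unfold cosh; rewrite Ropp_involutive; lra).
destruct (Rtotal_order x 0) as [l | [e | l]].
- assert (k := h (- x) ltac:(lra)). rewrite c in k. lra.
- subst; rewrite cosh_0; lra.
- apply Rlt_le, h, l.
Qed.

(** P + i b c and 1 + i b Q have the moduli sqrt n1 and sqrt n2 / a; in polar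
    coordinates for (P - i b c)(1 + i b Q) = W + i kap and for
    (P + i b c)(1 + i b Q) = U + i V the gap becomes the expression of
    [phase_gap_pos]. *)
Lemma mixed_gap_pos (P Q c a b d : R) :
  0 < P -> 0 < Q -> 0 < c -> 0 < a -> 0 < b -> 0 < d -> 0 <= P * Q - c ->
  a * (P * Q - c) <= P + b ^ 2 * Q * c ->
  b * (P * Q - c) <= 3 / 2 * (P + b ^ 2 * Q * c) ->
  P * Q - c <= 1 + b ^ 2 * Q ^ 2 ->
  0 < mixed_gap P Q c a b (sinh (b * d)) (cosh (b * d)) (cos (a * d)) (sin (a * d)).
Proof.
intros HP HQ Hc Ha Hb Hd K0 P1 P2 P3.
assert (X0 : 0 < b * d) by (apply Rmult_lt_0_compat; lra).
assert (sh0 := sinh_gt_id _ X0).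
assert (ch0 := cosh_ge_quadratic (b * d)).
assert (chs := cosh_sqr (b * d)).
set (sh := sinh (b * d)) in *; set (ch := cosh (b * d)) in *.
set (W := P + b ^ 2 * Q * c) in *. set (kap := b * (P * Q - c)) in *.
set (n1 := P ^ 2 + b ^ 2 * c ^ 2). set (n2 := a ^ 2 * (1 + b ^ 2 * Q ^ 2)).
assert (bb : 0 < b ^ 2) by (apply pow_lt; assumption).
assert (aa : 0 < a ^ 2) by (apply pow_lt; assumption).
assert (zz : 0 < 1 + b ^ 2 * Q ^ 2) by (assert (0 < Q ^ 2) by (apply pow_lt; assumption); nra).
assert (W0 : 0 < W).
{ unfold W. assert (0 < b ^ 2 * Q * c) by (repeat apply Rmult_lt_0_compat; try assumption; lra). lra. }
assert (k0 : 0 <= kap) by (unfold kap; apply Rmult_le_pos; lra).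
assert (N1 : 0 < n1).
{ unfold n1. assert (0 < P ^ 2) by (apply pow_lt; assumption).
  assert (0 < c ^ 2) by (apply pow_lt; assumption). nra. }
assert (N2 : 0 < n2) by (unfold n2; apply Rmult_lt_0_compat; assumption).
assert (R2 : 0 < W ^ 2 + kap ^ 2) by (assert (0 < W ^ 2) by (apply pow_lt; assumption); nra).
set (r := sqrt (W ^ 2 + kap ^ 2)).
assert (r0 : 0 < r) by (apply sqrt_lt_R0; assumption).
assert (rr : r ^ 2 = W ^ 2 + kap ^ 2) by (apply pow2_sqrt; lra).
set (De := atan (kap / W)).
set (al := atan (b * Q)).
assert (rW : sqrt (1 + (kap / W)²) = r / W).
{ replace (1 + (kap / W)²) with ((r / W) ^ 2).
  - apply sqrt_pow2. apply Rlt_le, Rdiv_lt_0_compat; assumption.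
  - unfold Rsqr. replace ((r / W) ^ 2) with (r ^ 2 / W ^ 2) by (field; lra).
    rewrite rr. field; lra. }
assert (cD : cos De = W / r) by (unfold De; rewrite cos_atan, rW; field; lra).
assert (sD : sin De = kap / r) by (unfold De; rewrite sin_atan, rW; field; lra).
assert (C2 : cos (2 * al) = (1 - b ^ 2 * Q ^ 2) / (1 + b ^ 2 * Q ^ 2)).
{ unfold al. rewrite cos_2a, cos_atan, sin_atan.
  assert (p : 0 < 1 + (b * Q)²) by (unfold Rsqr; nra).
  set (v := sqrt (1 + (b * Q)²)).
  assert (v0 : 0 < v) by (apply sqrt_lt_R0; assumption).
  assert (vv : v * v = 1 + b ^ 2 * Q ^ 2)
    by (unfold v; rewrite sqrt_sqrt; [unfold Rsqr; ring | lra]).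
  rewrite <- vv. replace (1 - b ^ 2 * Q ^ 2) with (2 - v * v) by (rewrite vv; ring).
  transitivity ((1 - b ^ 2 * Q ^ 2) / (v * v)); [field; lra |].
  f_equal. rewrite vv; ring. }
assert (S2 : sin (2 * al) = 2 * (b * Q) / (1 + b ^ 2 * Q ^ 2)).
{ unfold al. rewrite sin_2a, cos_atan, sin_atan.
  assert (p : 0 < 1 + (b * Q)²) by (unfold Rsqr; nra).
  set (v := sqrt (1 + (b * Q)²)).
  assert (v0 : 0 < v) by (apply sqrt_lt_R0; assumption).
  assert (vv : v * v = 1 + b ^ 2 * Q ^ 2)
    by (unfold v; rewrite sqrt_sqrt; [unfold Rsqr; ring | lra]).
  rewrite <- vv. field; lra. }
assert (cS : r * cos (2 * al - De) = P - b ^ 2 * Q * c).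
{ rewrite cos_minus, C2, S2, cD, sD. unfold W, kap. field. split; lra. }
assert (sS : r * sin (2 * al - De) = b * (P * Q + c)).
{ rewrite sin_minus, C2, S2, cD, sD. unfold W, kap. field. split; lra. }
set (g := a * r).
assert (g0 : 0 < g) by (apply Rmult_lt_0_compat; assumption).
assert (gg : g ^ 2 = n1 * n2).
{ unfold g. replace ((a * r) ^ 2) with (a ^ 2 * r ^ 2) by ring. rewrite rr.
  unfold W, kap, n1, n2; ring. }
assert (main : 0 < 2 * g * ((cos De * ch) ^ 2 - 1) + (n1 + n2) * (cos De * ch) * sh
      + (n1 - n2) * sh * cos (a * d + (2 * al - De))
      + 2 * g * sin De * ch * sin (a * d + (2 * al - De))).
{ assert (at0 : 0 <= De < PI / 2).
  { split; [| apply atan_bound]. unfold De. rewrite <- atan_0.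
    destruct (Req_dec kap 0) as [e | e].
    - rewrite e. unfold Rdiv; rewrite Rmult_0_l; lra.
    - apply Rlt_le, atan_increasing, Rdiv_lt_0_compat; lra. }
  assert (at1 : De < al).
  { apply atan_increasing. apply (Rmult_lt_reg_r W); [assumption |].
    replace (kap / W * W) with kap by (field; lra). unfold kap, W.
    assert (0 < b ^ 2 * Q * c * (b * Q)) by (repeat apply Rmult_lt_0_compat; try assumption; lra).
    assert (0 < b * c) by (apply Rmult_lt_0_compat; assumption). nra. }
  assert (at2 := atan_bound (b * Q)). fold al in at2.
  assert (ad : 0 <= a * d) by (apply Rmult_le_pos; lra).
  apply (phase_gap_pos n1 n2 g a b); try assumption; try lra.
  - nra.
  - replace (b * (a * d)) with (a * (b * d)) by ring. apply Rmult_le_compat_l; lra.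
  - replace (b ^ 2 * (a * d) ^ 2 / 2) with (a ^ 2 * ((b * d) ^ 2 / 2)) by field.
    apply Rmult_le_compat_l; lra.
  - rewrite cD, sD. unfold Rdiv. rewrite <- !Rmult_assoc.
    apply Rmult_le_compat_r; [apply Rlt_le, Rinv_0_lt_compat; lra |].
    unfold kap. assert (b * (a * (P * Q - c)) <= b * W) by (apply Rmult_le_compat_l; lra). lra.
  - rewrite sD. unfold g. replace (a * (a * r) * (kap / r)) with (a ^ 2 * kap) by (field; lra).
    unfold n2, kap. replace (b * (a ^ 2 * (1 + b ^ 2 * Q ^ 2)))
      with (a ^ 2 * (b * (1 + b ^ 2 * Q ^ 2))) by ring.
    apply Rmult_le_compat_l; [lra |]. apply Rmult_le_compat_l; lra.
  - rewrite cD. apply (Rmult_le_reg_r r); [assumption |].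
    replace (W / r * r) with W by (field; lra).
    assert (r ^ 2 <= (20 / 11 * W) ^ 2).
    { rewrite rr. assert (kap ^ 2 <= (3 / 2 * W) ^ 2) by (apply pow_incr; lra).
      assert (0 < W ^ 2) by (apply pow_lt; assumption). lra. }
    assert (r <= 20 / 11 * W) by nra. lra. }
unfold mixed_gap. fold W kap n1 n2.
match goal with |- 0 < ?f => replace f with (r * (2 * g * ((cos De * ch) ^ 2 - 1)
      + (n1 + n2) * (cos De * ch) * sh
      + (n1 - n2) * sh * cos (a * d + (2 * al - De))
      + 2 * g * sin De * ch * sin (a * d + (2 * al - De)))) end.
- apply Rmult_lt_0_compat; assumption.
- rewrite cos_plus, sin_plus, <- cS, <- sS, cD, sD. unfold g.
  transitivity (2 * a * (W ^ 2 * ch ^ 2 - r ^ 2) + W * (n1 + n2) * sh * ch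
    + (n1 - n2) * sh * (r * cos (2 * al - De) * cos (a * d) - r * sin (2 * al - De) * sin (a * d))
    + 2 * a * kap * ch * (r * sin (2 * al - De) * cos (a * d) + r * cos (2 * al - De) * sin (a * d))).
  + field; lra.
  + rewrite rr, chs. ring.
Qed.

(** With t = 1 / c and x = k^2, this is the square of a (P Q - c) <= P + b^2 Q c after
    division by (x / t^2)^2.  Equality holds in the limits t -> 0 and
    2 t^2 -> 1 at r = 0, which is why the Bernstein coefficient at r = 0 has the
    factor t (1 - 2 t^2). *)
Lemma phase_bound_poly (t r : R) : 0 < t -> 2 * t ^ 2 < 1 -> 0 <= r <= 1 ->
  let x := t ^ 2 + (1 - t ^ 2) * r in
  let g := 1 - 2 * t + 4 * t * x in
  (1 - x) * (g ^ 2) ^ 2 <= ((1 + t) * (g + 2 * t - 4 * t ^ 2)) ^ 2.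
Proof.
intros t0 t2 r0 x g.
assert (t1 : t < 5 / 7) by nra.
assert (A0 : 0 <= 10 - 40 * t + 60 * t ^ 2 + 8 * t ^ 3 - 168 * t ^ 4 + 224 * t ^ 5 + 32 * t ^ 6 - 320 * t ^ 7 + 192 * t ^ 8 + 128 * t ^ 9 - 128 * t ^ 10).
{ apply (hform_nonneg [10; 280; 3420; 25176; 126840; 445536; 1125408; 2238528; 2971584; 3449728; 1813888]%Z t (3 - 4 * t) 59049); [reflexivity | lra | lra | lra | simpl; ring]. }
assert (A1 : 0 <= 1 + 33 * t - 48 * t ^ 2 - 152 * t ^ 3 + 384 * t ^ 4 + 16 * t ^ 5 - 848 * t ^ 6 + 624 * t ^ 7 + 768 * t ^ 8 - 1024 * t ^ 9 - 256 * t ^ 10 + 512 * t ^ 11).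
{ apply (hform_nonneg [1; 242; 13045; 325820; 4642930; 42127084; 261015698; 1116708640; 3199576365; 6549800210; 6363462489; 918965428]%Z t (5 - 7 * t) 48828125); [reflexivity | lra | lra | lra | simpl; ring]. }
assert (A2 : 0 <= 4 + 48 * t + 16 * t ^ 2 - 240 * t ^ 3 + 32 * t ^ 4 + 448 * t ^ 5 - 48 * t ^ 6 - 624 * t ^ 7 + 384 * t ^ 9).
{ apply (hform_nonneg [4; 288; 7056; 83568; 540576; 2024640; 4751184; 7412976; 4139136; 310144]%Z t (3 - 4 * t) 19683); [reflexivity | lra | lra | lra | simpl; ring]. }
assert (A3 : 0 <= 6 + 46 * t + 32 * t ^ 2 - 144 * t ^ 3 + 16 * t ^ 4 - 32 * t ^ 5 - 48 * t ^ 6 + 144 * t ^ 7).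
{ apply (hform_nonneg [2; 102; 1872; 16144; 71856; 159264; 119408; 32208]%Z t (3 - 4 * t) 729); [reflexivity | lra | lra | lra | simpl; ring]. }
assert (A4 : 0 <= 4 + 30 * t + 24 * t ^ 2 - 120 * t ^ 3 + 8 * t ^ 4 + 96 * t ^ 5 - 32 * t ^ 6).
{ apply (hform_nonneg [4; 54; 234; 356; 152; 22; 10]%Z t (1 - t) 1); [reflexivity | lra | lra | lra | simpl; ring]. }
assert (A5 : 0 <= 1 + 9 * t + 16 * t ^ 2 - 24 * t ^ 3 - 16 * t ^ 4 + 16 * t ^ 5).
{ apply (hform_nonneg [1; 14; 62; 88; 25; 2]%Z t (1 - t) 1); [reflexivity | lra | lra | lra | simpl; ring]. }
match goal with |- ?a <= ?b => assert (E : b - a = (1 + t) *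
  (t * (1 - 2 * t ^ 2) * (10 - 40 * t + 60 * t ^ 2 + 8 * t ^ 3 - 168 * t ^ 4 + 224 * t ^ 5 + 32 * t ^ 6 - 320 * t ^ 7 + 192 * t ^ 8 + 128 * t ^ 9 - 128 * t ^ 10) * (1 - r) ^ 5
   + r * (1 - r) ^ 4 * (1 + 33 * t - 48 * t ^ 2 - 152 * t ^ 3 + 384 * t ^ 4 + 16 * t ^ 5 - 848 * t ^ 6 + 624 * t ^ 7 + 768 * t ^ 8 - 1024 * t ^ 9 - 256 * t ^ 10 + 512 * t ^ 11) + r ^ 2 * (1 - r) ^ 3 * (4 + 48 * t + 16 * t ^ 2 - 240 * t ^ 3 + 32 * t ^ 4 + 448 * t ^ 5 - 48 * t ^ 6 - 624 * t ^ 7 + 384 * t ^ 9)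
   + r ^ 3 * (1 - r) ^ 2 * (6 + 46 * t + 32 * t ^ 2 - 144 * t ^ 3 + 16 * t ^ 4 - 32 * t ^ 5 - 48 * t ^ 6 + 144 * t ^ 7) + r ^ 4 * (1 - r) * (4 + 30 * t + 24 * t ^ 2 - 120 * t ^ 3 + 8 * t ^ 4 + 96 * t ^ 5 - 32 * t ^ 6)
   + r ^ 5 * (1 + 9 * t + 16 * t ^ 2 - 24 * t ^ 3 - 16 * t ^ 4 + 16 * t ^ 5))) end.
{ unfold g, x; ring. }
apply Rminus_le_0. rewrite E.
apply Rmult_le_pos; [lra |].
repeat apply Rplus_le_le_0_compat; repeat apply Rmult_le_pos;
  try apply pow_le; try assumption; lra.
Qed.

Lemma angle_bound_poly (t r : R) : 0 < t -> 2 * t ^ 2 < 1 -> 0 <= r <= 1 ->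
  let x := t ^ 2 + (1 - t ^ 2) * r in
  let g := 1 - 2 * t + 4 * t * x in
  4 * (x - t ^ 2) * (g ^ 2) ^ 2 <= 9 * ((1 + t) * (g + 2 * t - 4 * t ^ 2)) ^ 2.
Proof.
intros t0 t2 r0 x g.
assert (t1 : t < 5 / 7) by nra.
assert (B0 : 0 <= 9 + 9 * t - 72 * t ^ 2 + 216 * t ^ 4 - 144 * t ^ 5 - 144 * t ^ 6 + 144 * t ^ 7).
{ apply (hform_nonneg [9; 90; 324; 504; 342; 180; 180; 72; 9; 18]%Z t (1 - t) 1); [reflexivity | lra | lra | lra | simpl; ring]. }
assert (B1 : 0 <= 41 + 153 * t - 416 * t ^ 2 - 200 * t ^ 3 + 1264 * t ^ 4 - 1232 * t ^ 5 + 176 * t ^ 6 + 1840 * t ^ 7 - 3072 * t ^ 8 + 512 * t ^ 9 + 3072 * t ^ 10 - 2048 * t ^ 11 - 1024 * t ^ 12 + 1024 * t ^ 13).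
{ apply (hform_nonneg [41; 686; 4618; 17048; 39359; 61006; 66076; 52288; 33287; 17706; 7290; 3240; 369; 90]%Z t (1 - t) 1); [reflexivity | lra | lra | lra | simpl; ring]. }
assert (B2 : 0 <= 74 + 458 * t - 352 * t ^ 2 - 1744 * t ^ 3 + 2672 * t ^ 4 + 704 * t ^ 5 - 4368 * t ^ 6 + 2736 * t ^ 7 + 3072 * t ^ 8 - 4096 * t ^ 9 - 1024 * t ^ 10 + 2048 * t ^ 11).
{ apply (hform_nonneg [74; 1272; 8298; 27908; 55428; 71376; 63556; 39144; 17874; 7704; 306; 180]%Z t (1 - t) 1); [reflexivity | lra | lra | lra | simpl; ring]. }
assert (B3 : 0 <= 66 + 546 * t + 336 * t ^ 2 - 2112 * t ^ 3 + 288 * t ^ 4 + 2688 * t ^ 5 - 624 * t ^ 6 - 2544 * t ^ 7 + 1536 * t ^ 9).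
{ apply (hform_nonneg [66; 1206; 8220; 28152; 54636; 64308; 49392; 26280; 7506; 54; 180]%Z t (1 - t) 1); [reflexivity | lra | lra | lra | simpl; ring]. }
assert (B4 : 0 <= 29 + 285 * t + 424 * t ^ 2 - 816 * t ^ 3 - 392 * t ^ 4 + 80 * t ^ 5 - 32 * t ^ 6 + 512 * t ^ 7).
{ apply (hform_nonneg [29; 604; 4869; 20610; 52114; 83352; 85162; 53556; 18513; 2556; 81; 90]%Z t (1 - t) 1); [reflexivity | lra | lra | lra | simpl; ring]. }
assert (B5 : 0 <= 5 + 53 * t + 80 * t ^ 2 - 248 * t ^ 3 - 80 * t ^ 4 + 208 * t ^ 5).
{ apply (hform_nonneg [5; 108; 885; 3682; 8826; 12864; 11426; 5820; 1377; 36; 9; 18]%Z t (1 - t) 1); [reflexivity | lra | lra | lra | simpl; ring]. }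
match goal with |- ?a <= ?b => assert (E : b - a = (1 + t) *
  ((1 - r) ^ 5 * (9 + 9 * t - 72 * t ^ 2 + 216 * t ^ 4 - 144 * t ^ 5 - 144 * t ^ 6 + 144 * t ^ 7)
   + r * (1 - r) ^ 4 * (41 + 153 * t - 416 * t ^ 2 - 200 * t ^ 3 + 1264 * t ^ 4 - 1232 * t ^ 5 + 176 * t ^ 6 + 1840 * t ^ 7 - 3072 * t ^ 8 + 512 * t ^ 9 + 3072 * t ^ 10 - 2048 * t ^ 11 - 1024 * t ^ 12 + 1024 * t ^ 13) + r ^ 2 * (1 - r) ^ 3 * (74 + 458 * t - 352 * t ^ 2 - 1744 * t ^ 3 + 2672 * t ^ 4 + 704 * t ^ 5 - 4368 * t ^ 6 + 2736 * t ^ 7 + 3072 * t ^ 8 - 4096 * t ^ 9 - 1024 * t ^ 10 + 2048 * t ^ 11)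
   + r ^ 3 * (1 - r) ^ 2 * (66 + 546 * t + 336 * t ^ 2 - 2112 * t ^ 3 + 288 * t ^ 4 + 2688 * t ^ 5 - 624 * t ^ 6 - 2544 * t ^ 7 + 1536 * t ^ 9) + r ^ 4 * (1 - r) * (29 + 285 * t + 424 * t ^ 2 - 816 * t ^ 3 - 392 * t ^ 4 + 80 * t ^ 5 - 32 * t ^ 6 + 512 * t ^ 7)
   + r ^ 5 * (5 + 53 * t + 80 * t ^ 2 - 248 * t ^ 3 - 80 * t ^ 4 + 208 * t ^ 5))) end.
{ unfold g, x; ring. }
apply Rminus_le_0. rewrite E.
apply Rmult_le_pos; [lra |].
repeat apply Rplus_le_le_0_compat; repeat apply Rmult_le_pos;
  try apply pow_le; try assumption; lra.
Qed.

(** After multiplication by t^2 / x, where t = 1 / c, the difference P Q - c becomes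
    the square of g = 1 - 2 t + 4 t x, and P + b^2 Q c becomes
    (1 + t)(g + 2 t - 4 t^2). *)
Lemma mixed_stiffness (c x : R) : 0 < c -> 2 < c ^ 2 -> 1 / c ^ 2 < x < 1 ->
  let P := stiffP c x in
  let Q := stiffQ c x in
  let a := sqrt (1 - x) in
  let b := sqrt (x - 1 / c ^ 2) in
  a * (P * Q - c) <= P + b ^ 2 * Q * c /\
  b * (P * Q - c) <= 3 / 2 * (P + b ^ 2 * Q * c) /\
  P * Q - c <= 1 + b ^ 2 * Q ^ 2.
Proof.
intros c0 c2 hx P Q a b.
set (t := / c).
assert (t0 : 0 < t) by (apply Rinv_0_lt_compat; assumption).
assert (ct : c * t = 1) by (unfold t; field; lra).
assert (e2 : 1 / c ^ 2 = t ^ 2) by (unfold t; field; lra).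
assert (ec : c = / t) by (unfold t; rewrite Rinv_inv; reflexivity).
rewrite e2 in hx.
assert (t2 : 2 * t ^ 2 < 1).
{ assert (c ^ 2 * t ^ 2 = 1) by (rewrite <- Rpow_mult_distr, ct; ring).
  assert (0 < t ^ 2) by (apply pow_lt; assumption). nra. }
assert (t1 : t < 1) by nra.
assert (aa : a ^ 2 = 1 - x) by (apply pow2_sqrt; lra).
assert (bb : b ^ 2 = x - t ^ 2) by (unfold b; rewrite e2; apply pow2_sqrt; lra).
assert (a0 : 0 <= a) by apply sqrt_pos. assert (b0 : 0 <= b) by apply sqrt_pos.
set (g := 1 - 2 * t + 4 * t * x). set (h := g + 2 * t - 4 * t ^ 2).
assert (h0 : 0 < h).
{ unfold h, g. assert (t ^ 3 <= t * x) by (simpl; nra).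
  assert (0 < 1 - 4 * t ^ 2 + 4 * t ^ 3).
  { (* The minimum of 1 - 4 t^2 + 4 t^3 is 11 / 27, at t = 2 / 3. *)
    assert (0 <= (3 * t - 2) ^ 2 * (3 * t + 1)) by (apply Rmult_le_pos; [apply pow2_ge_0 | lra]).
    nra. }
  lra. }
set (r := (x - t ^ 2) / (1 - t ^ 2)).
assert (tt : 0 < 1 - t ^ 2) by nra.
assert (ex : x = t ^ 2 + (1 - t ^ 2) * r) by (unfold r; field; lra).
assert (r01 : 0 <= r <= 1).
{ split.
  - apply Rlt_le, Rdiv_lt_0_compat; lra.
  - apply (Rmult_le_reg_r (1 - t ^ 2)); [assumption |].
    replace (r * (1 - t ^ 2)) with (x - t ^ 2) by (unfold r; field; lra). lra. }
assert (q1 := phase_bound_poly t r t0 t2 r01). assert (q2 := angle_bound_poly t r t0 t2 r01).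
rewrite <- ex in q1, q2. fold g in q1, q2. fold h in q1, q2.
assert (H0 : 0 < (1 + t) * h) by (apply Rmult_lt_0_compat; lra).
assert (g2 : 0 <= g ^ 2) by apply pow2_ge_0.
assert (i1 : a * g ^ 2 <= (1 + t) * h).
{ assert ((a * g ^ 2) ^ 2 <= ((1 + t) * h) ^ 2)
    by (replace ((a * g ^ 2) ^ 2) with ((1 - x) * (g ^ 2) ^ 2) by (rewrite <- aa; ring); exact q1).
  assert (0 <= a * g ^ 2) by (apply Rmult_le_pos; assumption). nra. }
assert (i2 : 2 * (b * g ^ 2) <= 3 * ((1 + t) * h)).
{ assert ((2 * (b * g ^ 2)) ^ 2 <= (3 * ((1 + t) * h)) ^ 2).
  { replace ((2 * (b * g ^ 2)) ^ 2) with (4 * (x - t ^ 2) * (g ^ 2) ^ 2) by (rewrite <- bb; ring).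
    replace ((3 * ((1 + t) * h)) ^ 2) with (9 * ((1 + t) * h) ^ 2) by ring. exact q2. }
  assert (0 <= b * g ^ 2) by (apply Rmult_le_pos; assumption). nra. }
assert (tp : 0 < t ^ 2) by (apply pow_lt; assumption).
assert (xt : 0 < x / t ^ 2) by (apply Rdiv_lt_0_compat; lra).
assert (eW : P + b ^ 2 * Q * c = x / t ^ 2 * ((1 + t) * h)).
{ rewrite bb. unfold P, Q, stiffP, stiffQ, h, g. rewrite ec. field. lra. }
assert (eK : P * Q - c = x / t ^ 2 * g ^ 2).
{ unfold P, Q, stiffP, stiffQ, g. rewrite ec. field. lra. }
rewrite eW, eK. repeat split.
- assert (x / t ^ 2 * (a * g ^ 2) <= x / t ^ 2 * ((1 + t) * h))
    by (apply Rmult_le_compat_l; lra). lra.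
- assert (x / t ^ 2 * (2 * (b * g ^ 2)) <= x / t ^ 2 * (3 * ((1 + t) * h)))
    by (apply Rmult_le_compat_l; lra). lra.
- rewrite <- eK, bb. apply Rminus_le_0.
  replace (1 + (x - t ^ 2) * Q ^ 2 - (P * Q - c))
    with (4 * x * (4 * (x - t ^ 2) * (1 - t ^ 2) + (1 - 2 * t ^ 2) * (1 - t + 2 * t ^ 3) / t)).
  2: { unfold P, Q, stiffP, stiffQ. rewrite ec. field. lra. }
  apply Rmult_le_pos; [lra |]. apply Rplus_le_le_0_compat.
  + apply Rmult_le_pos; lra.
  + apply Rlt_le, Rdiv_lt_0_compat; [| assumption].
    assert (0 < t ^ 3) by (apply pow_lt; assumption). apply Rmult_lt_0_compat; lra.
Qed.

Lemma rho_lt1_mixed (sg Cs c k delta : R) :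
  0 < sg -> 0 < Cs -> 0 < c -> 2 < c ^ 2 -> 0 < delta -> 1 / c ^ 2 < k ^ 2 < 1 ->
  rho_T0 (sg * k) (sg * Cs) (c * Cs) Cs delta < 1.
Proof.
intros hs hC hc c2 hd hk.
assert (P0 := stiffP_pos c (k ^ 2) hc (pow2_ge_0 k)).
assert (Q0 := stiffQ_pos c (k ^ 2) hc (pow2_ge_0 k)).
destruct (mixed_stiffness c (k ^ 2) hc c2 hk) as [p1 [p2 p3]].
set (a := sqrt (1 - k ^ 2)) in *. set (b := sqrt (k ^ 2 - 1 / c ^ 2)) in *.
assert (a0 : 0 < a) by (apply sqrt_lt_R0; lra).
assert (b0 : 0 < b) by (apply sqrt_lt_R0; lra).
apply (rho_lt1_of_mode_form sg Cs c k delta (0, a) b); try assumption.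
- rewrite Csqrt_scaled_neg by lra. unfold a. do 3 f_equal. ring.
- apply Csqrt_scaled_pos; lra.
- intros h. apply (f_equal Re) in h. rewrite Re_mode_den_mixed in h. change (Re 0%C) with 0 in h; lra.
- intros n. rewrite Cexp_propagating, Cexp_evanescent.
  assert (d0 : 0 < sg * delta) by (apply Rmult_lt_0_compat; assumption).
  set (d := sg * delta) in *.
  assert (bd : 0 < b * d) by (apply Rmult_lt_0_compat; assumption).
  assert (ip : / exp (- b * d) = exp (b * d)).
  { rewrite <- exp_Ropp. f_equal; ring. }
  assert (im : exp (- b * d) = exp (- (b * d))) by (f_equal; ring).
  apply root_lt1_mixed; try assumption.
  + split; [apply exp_pos |]. rewrite <- exp_0. apply exp_increasing. lra.
  + assert (h := sin2_cos2 (a * d)). unfold Rsqr in h. lra.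
  + rewrite ip, im. apply mixed_gap_pos; try assumption.
    rewrite coupling_sqr. apply pow2_ge_0.
Qed.

(** * Both waves evanescent: hyperbolic estimates *)

Lemma derive_nonneg_le (f df : R -> R) (a b : R) : a <= b ->
  (forall x, a <= x <= b -> is_derive f x (df x)) ->
  (forall x, a <= x <= b -> 0 <= df x) -> f a <= f b.
Proof.
intros ab D P.
destruct (Req_dec a b) as [e | e]; [subst; lra |].
destruct (MVT_cor2 f df a b) as [c [E Hc]]; [lra | |].
- intros c Hc; apply is_derive_Reals, D, Hc.
- assert (h := P c ltac:(lra)). nra.
Qed.

Definition xcoth (x : R) : R := x * cosh x / sinh x.

Lemma sinh_pos x : 0 < x -> 0 < sinh x.
Proof. intros h; assert (g := sinh_gt_id x h); lra. Qed.

Lemma xcoth_gt1 x : 0 < x -> 1 < xcoth x.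
Proof.
intros h. assert (s := sinh_pos x h). assert (g := sinh_lt_mul_cosh x h).
apply (Rmult_lt_reg_r (sinh x)); [assumption |].
unfold xcoth. replace (x * cosh x / sinh x * sinh x) with (x * cosh x) by (field; lra). lra.
Qed.

(** The derivative of [xcoth] with respect to log x. *)
Definition xcoth_logderiv (x : R) : R := x * (cosh x * sinh x - x) / sinh x ^ 2.

Lemma is_derive_xcoth x : 0 < x ->
  is_derive xcoth x ((cosh x * sinh x - x) / sinh x ^ 2).
Proof.
intros h. assert (s := sinh_pos x h). assert (q := cosh_sqr x).
replace ((cosh x * sinh x - x) / sinh x ^ 2)
  with (((1 * cosh x + x * sinh x) * sinh x - x * cosh x * cosh x) / sinh x ^ 2).
- apply (is_derive_div (fun x => x * cosh x) sinh).
  + apply (is_derive_mult (fun x => x) cosh).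
    * apply @is_derive_id.
    * apply is_derive_cosh.
    * intros; apply Rmult_comm.
  + apply is_derive_sinh.
  + lra.
- f_equal. replace (x * cosh x * cosh x) with (x * cosh x ^ 2) by ring. rewrite q; ring.
Qed.

Lemma is_derive_xcoth_logderiv x : 0 < x ->
  is_derive xcoth_logderiv x
    ((cosh x * sinh x ^ 2 - 3 * x * sinh x + 2 * x ^ 2 * cosh x) / sinh x ^ 3).
Proof.
intros h. assert (s := sinh_pos x h). assert (q := cosh_sqr x).
assert (D1 : is_derive (fun x => x * (cosh x * sinh x - x)) x
  (1 * (cosh x * sinh x - x) + x * ((sinh x * sinh x + cosh x * cosh x) - 1))).
{ apply (is_derive_mult (fun x => x) (fun x => cosh x * sinh x - x)).
  - apply @is_derive_id.
  - apply (is_derive_minus (fun x => cosh x * sinh x) (fun x => x)).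
    + apply (is_derive_mult cosh sinh); [apply is_derive_cosh | apply is_derive_sinh |].
      intros; apply Rmult_comm.
    + apply @is_derive_id.
  - intros; apply Rmult_comm. }
assert (D2 : is_derive (fun x => sinh x ^ 2) x (INR 2 * cosh x * sinh x ^ 1)).
{ apply (is_derive_pow sinh 2). apply is_derive_sinh. }
assert (D := is_derive_div _ _ _ _ _ D1 D2 (pow_nonzero _ 2 (Rgt_not_eq _ _ s))).
replace ((cosh x * sinh x ^ 2 - 3 * x * sinh x + 2 * x ^ 2 * cosh x) / sinh x ^ 3)
  with (((1 * (cosh x * sinh x - x) + x * ((sinh x * sinh x + cosh x * cosh x) - 1)) * sinh x ^ 2
    - x * (cosh x * sinh x - x) * (INR 2 * cosh x * sinh x ^ 1)) / (sinh x ^ 2) ^ 2); [exact D |].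
simpl INR.
replace ((1 * (cosh x * sinh x - x) + x * (sinh x * sinh x + cosh x * cosh x - 1)) * sinh x ^ 2
    - x * (cosh x * sinh x - x) * ((1 + 1) * cosh x * sinh x ^ 1))
  with (sinh x * (cosh x * sinh x ^ 2 - 3 * x * sinh x + 2 * x ^ 2 * cosh x)
    + x * sinh x ^ 2 * (1 + sinh x ^ 2 - cosh x ^ 2)) by ring.
rewrite q. field. lra.
Qed.

Lemma xcoth_logderiv_incr x y : 0 < x -> x <= y -> xcoth_logderiv x <= xcoth_logderiv y.
Proof.
intros hx hy.
apply (derive_nonneg_le _ _ x y hy (fun v hv => is_derive_xcoth_logderiv v ltac:(lra))).
intros v hv. assert (v0 : 0 < v) by lra.
assert (s := sinh_gt_id v v0). assert (g := sinh_lt_mul_cosh v v0).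
assert (c0 := cosh_gt_sinh v).
apply Rlt_le, Rdiv_lt_0_compat; [| apply pow_lt; lra].
assert (c1 : 0 < cosh v) by lra.
assert (h1 : sinh v * sinh v <= (v * cosh v) * (v * cosh v)).
{ apply Rmult_le_compat; lra. }
apply (Rmult_lt_reg_l (cosh v)); [assumption |]. rewrite Rmult_0_r.
assert (q := cosh_sqr v).
assert (0 < (v * cosh v - sinh v) * (2 * (v * cosh v) - sinh v))
  by (apply Rmult_lt_0_compat; lra).
assert (0 <= sinh v ^ 2 * sinh v ^ 2) by (apply Rmult_le_pos; apply pow2_ge_0).
replace (cosh v * (cosh v * sinh v ^ 2 - 3 * v * sinh v + 2 * v ^ 2 * cosh v))
  with ((v * cosh v - sinh v) * (2 * (v * cosh v) - sinh v) + sinh v ^ 2 * (cosh v ^ 2 - 1))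
  by ring.
rewrite q. replace (1 + sinh v ^ 2 - 1) with (sinh v ^ 2) by ring. lra.
Qed.

Lemma is_derive_scaled_exp u s : is_derive (fun s => u * exp s) s (u * exp s).
Proof. auto_derive; [easy | ring]. Qed.

Lemma is_derive_scaled_exp_opp u s : is_derive (fun s => u * exp (- s)) s (- (u * exp (- s))).
Proof. auto_derive; [easy | ring]. Qed.

(** x coth x is a convex function of log x. *)
Lemma xcoth_geometric u s : 0 < u -> 0 <= s ->
  2 * xcoth u <= xcoth (u * exp s) + xcoth (u * exp (- s)).
Proof.
intros hu hs.
assert (pos : forall v, 0 < u * exp v)
  by (intros v; apply Rmult_lt_0_compat; [assumption | apply exp_pos]).
replace (2 * xcoth u) with (xcoth (u * exp 0) + xcoth (u * exp (- 0)))
  by (rewrite Ropp_0, exp_0, Rmult_1_r; ring).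
apply (derive_nonneg_le (fun s => xcoth (u * exp s) + xcoth (u * exp (- s)))
  (fun s => xcoth_logderiv (u * exp s) - xcoth_logderiv (u * exp (- s)))); [assumption | |].
- intros v _.
  assert (D1 := is_derive_comp xcoth (fun s => u * exp s) v _ _
    (is_derive_xcoth _ (pos v)) (is_derive_scaled_exp u v)).
  assert (D2 := is_derive_comp xcoth (fun s => u * exp (- s)) v _ _
    (is_derive_xcoth _ (pos (- v))) (is_derive_scaled_exp_opp u v)).
  assert (D := is_derive_plus _ _ _ _ _ D1 D2).
  match type of D with is_derive _ _ ?l =>
    replace (xcoth_logderiv (u * exp v) - xcoth_logderiv (u * exp (- v))) with l;
      [exact D |] end.
  unfold xcoth_logderiv, plus, scal; simpl; unfold mult; simpl.
  assert (s1 := sinh_pos _ (pos v)). assert (s2 := sinh_pos _ (pos (- v))).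
  field. lra.
- intros v hv.
  assert (h : xcoth_logderiv (u * exp (- v)) <= xcoth_logderiv (u * exp v)); [| lra].
  apply xcoth_logderiv_incr; [apply pos |].
  apply Rmult_le_compat_l; [lra |].
  destruct (Req_dec v 0) as [e | e].
  + rewrite e, Ropp_0; lra.
  + apply Rlt_le, exp_increasing; lra.
Qed.

Lemma is_derive_ln_sinh x : 0 < x -> is_derive (fun x => ln (sinh x)) x (cosh x / sinh x).
Proof.
intros h. assert (s := sinh_pos x h).
assert (D := is_derive_comp ln sinh x _ _ (is_derive_ln _ s) (is_derive_sinh x)).
replace (cosh x / sinh x) with (scal (cosh x) (/ sinh x)); [exact D |].
unfold scal; simpl; unfold mult; simpl; field; lra.
Qed.

(** x coth x is the derivative of log sinh x with respect to log x, so this is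
    [xcoth_geometric] integrated. *)
Lemma ln_sinh_geometric u s : 0 < u -> 0 <= s ->
  2 * xcoth u * s <= ln (sinh (u * exp s)) - ln (sinh (u * exp (- s))).
Proof.
intros hu hs.
assert (pos : forall v, 0 < u * exp v)
  by (intros v; apply Rmult_lt_0_compat; [assumption | apply exp_pos]).
set (F := fun s => ln (sinh (u * exp s)) - ln (sinh (u * exp (- s))) - 2 * xcoth u * s).
assert (h : F 0 <= F s).
{ apply (derive_nonneg_le F
    (fun s => xcoth (u * exp s) + xcoth (u * exp (- s)) - 2 * xcoth u)); [assumption | |].
  - intros v _.
    assert (D1 := is_derive_comp (fun x => ln (sinh x)) (fun s => u * exp s) v _ _
      (is_derive_ln_sinh _ (pos v)) (is_derive_scaled_exp u v)).
    assert (D2 := is_derive_comp (fun x => ln (sinh x)) (fun s => u * exp (- s)) v _ _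
      (is_derive_ln_sinh _ (pos (- v))) (is_derive_scaled_exp_opp u v)).
    assert (D3 : is_derive (fun s => 2 * xcoth u * s) v (2 * xcoth u))
      by (auto_derive; [easy | ring]).
    assert (D := is_derive_minus _ _ _ _ _ (is_derive_minus _ _ _ _ _ D1 D2) D3).
    match type of D with is_derive _ _ ?l =>
      replace (xcoth (u * exp v) + xcoth (u * exp (- v)) - 2 * xcoth u) with l;
        [exact D |] end.
    unfold minus, plus, opp, scal; simpl; unfold mult; simpl.
    unfold xcoth at 2 3.
    assert (s1 := sinh_pos _ (pos v)). assert (s2 := sinh_pos _ (pos (- v))).
    field. lra.
  - intros v hv. assert (g := xcoth_geometric u v hu ltac:(lra)). lra. }
unfold F in h. rewrite Ropp_0 in h. lra.
Qed.

(** With m = u coth u, the previous lemma bounds the squared ratio from below by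
    z^(4 m) = z^4 exp (4 (m - 1) log z).  The exponential is bounded by its tangent
    and the logarithm by 4 log z >= 2 (z^4 - 1) / (z^4 + 1), which gives a rational
    bound that is exact to first order at z = 1. *)
Lemma sinh_ratio_bound u z : 0 < u -> 1 <= z ->
  sinh (u / z) ^ 2 * (1 + (z ^ 4 - 1) * (1 + 2 * (xcoth u - 1) * z ^ 4 / (z ^ 4 + 1)))
  <= sinh (u * z) ^ 2.
Proof.
intros hu hz.
set (s := ln z).
assert (ez : exp s = z) by (apply exp_ln; lra).
assert (es : exp (- s) = / z) by (rewrite exp_Ropp, ez; reflexivity).
assert (hs : 0 <= s) by (unfold s; rewrite <- ln_1; apply ln_le; lra).
assert (h := ln_sinh_geometric u s hu hs).
rewrite ez, es in h. fold (u / z) in h.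
assert (p1 : 0 < sinh (u * z)) by (apply sinh_pos, Rmult_lt_0_compat; lra).
assert (p2 : 0 < sinh (u / z)) by (apply sinh_pos, Rdiv_lt_0_compat; lra).
assert (m1 := xcoth_gt1 u hu). set (m := xcoth u) in *.
assert (z4 : 1 <= z ^ 4) by (apply pow_R1_Rle; assumption).
assert (e4 : exp (4 * s) = z ^ 4).
{ replace (4 * s) with (s + s + s + s) by ring. rewrite !exp_plus, ez; ring. }
assert (R : exp (4 * s) * exp (4 * (m - 1) * s) <= sinh (u * z) ^ 2 / sinh (u / z) ^ 2).
{ rewrite <- exp_plus.
  replace (sinh (u * z) ^ 2 / sinh (u / z) ^ 2)
    with (exp (2 * (ln (sinh (u * z)) - ln (sinh (u / z))))).
  - assert (hh : 4 * s + 4 * (m - 1) * s <= 2 * (ln (sinh (u * z)) - ln (sinh (u / z)))) by lra.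
    destruct hh as [hh | hh]; [apply Rlt_le, exp_increasing, hh | rewrite hh; apply Rle_refl].
  - replace (2 * (ln (sinh (u * z)) - ln (sinh (u / z))))
      with (ln (sinh (u * z)) + ln (sinh (u * z))
            + - (ln (sinh (u / z)) + ln (sinh (u / z)))) by ring.
    rewrite exp_plus, exp_Ropp, !exp_plus, !exp_ln by assumption. field. lra. }
rewrite e4 in R.
assert (E1 := exp_ineq1_le (4 * (m - 1) * s)).
assert (T : (z ^ 4 - 1) / (z ^ 4 + 1) <= 2 * s).
{ assert (c : sinh (2 * s) <= 2 * s * cosh (2 * s)).
  { destruct (Req_dec s 0) as [e | e].
    - rewrite e, Rmult_0_r, sinh_0; lra.
    - apply Rlt_le, sinh_lt_mul_cosh; lra. }
  assert (e2 : exp (2 * s) = z ^ 2).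
  { replace (2 * s) with (s + s) by ring. rewrite !exp_plus, ez; ring. }
  unfold sinh, cosh in c. rewrite exp_Ropp, e2 in c.
  assert (z2 : 0 < z ^ 2) by (apply pow_lt; lra).
  apply (Rmult_le_reg_r ((z ^ 4 + 1) / (2 * z ^ 2))).
  - apply Rdiv_lt_0_compat; lra.
  - replace ((z ^ 4 - 1) / (z ^ 4 + 1) * ((z ^ 4 + 1) / (2 * z ^ 2)))
      with ((z ^ 2 - / z ^ 2) / 2) by (field; split; lra).
    replace (2 * s * ((z ^ 4 + 1) / (2 * z ^ 2)))
      with (2 * s * ((z ^ 2 + / z ^ 2) / 2)) by (field; lra).
    exact c. }
assert (B : z ^ 4 * (1 + 2 * (m - 1) * ((z ^ 4 - 1) / (z ^ 4 + 1)))
   <= sinh (u * z) ^ 2 / sinh (u / z) ^ 2).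
{ apply Rle_trans with (2 := R). apply Rmult_le_compat_l; [lra |].
  assert ((m - 1) * ((z ^ 4 - 1) / (z ^ 4 + 1)) <= (m - 1) * (2 * s))
    by (apply Rmult_le_compat_l; lra).
  lra. }
replace (sinh (u * z) ^ 2) with (sinh (u / z) ^ 2 * (sinh (u * z) ^ 2 / sinh (u / z) ^ 2))
  by (field; lra).
apply Rmult_le_compat_l; [apply pow2_ge_0 |].
replace (1 + (z ^ 4 - 1) * (1 + 2 * (m - 1) * z ^ 4 / (z ^ 4 + 1)))
  with (z ^ 4 * (1 + 2 * (m - 1) * ((z ^ 4 - 1) / (z ^ 4 + 1)))) by (field; lra).
exact B.
Qed.

Lemma sinh_mul_ge u z : 0 < u -> 1 <= z -> z * sinh u <= sinh (u * z).
Proof.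
intros hu hz.
assert (h : sinh (u * 1) - 1 * sinh u <= sinh (u * z) - z * sinh u).
{ apply (derive_nonneg_le (fun z => sinh (u * z) - z * sinh u)
    (fun z => u * cosh (u * z) - sinh u)); [assumption | |].
  - intros v _. unfold sinh, cosh. auto_derive; [easy | field].
  - intros v hv. assert (g := sinh_lt_mul_cosh u hu).
    assert (cosh u <= cosh (u * v)).
    { apply (derive_nonneg_le cosh sinh); [nra | |].
      - intros w _; apply is_derive_cosh.
      - intros w hw; apply Rlt_le, sinh_pos; lra. }
    nra. }
rewrite Rmult_1_r in h. lra.
Qed.

(** * Both waves evanescent: the rational inequality *)

Definition core_factor (c Y : R) : R := (c + 2) * (1 - Y) + (1 - 1 / c ^ 2) * Y ^ 2.

(** The inequality of the evanescent range, multiplied by 1 - Y where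
    1 - Y = 1 / z^2, is the positivity of [core_base] plus a term that vanishes with
    T = tanh^2 u plus a multiple of [core_slack] that vanishes for
    M = tanh u / u = 1. *)
Definition core_base (c Y : R) : R :=
  let L := 1 - 1 / c ^ 2 in
  let G := core_factor c Y in
  (1 - Y) * (1 + c - L * Y) ^ 2 - (1 + c - L * Y) * L * Y * G - L * G ^ 2
  + c * L * Y * (2 - Y).

Definition core_slack (c Y : R) : R :=
  (1 - 1 / c ^ 2) * core_factor c Y ^ 2 * (1 + (1 - 1 / c ^ 2) * Y ^ 2 / (4 * (1 - Y))).

(** The case M = 1, with T the value for which the threshold condition is then an
    equality.  The expression has a double zero at c = 2, where T = 1. *)
Lemma overlap_core_M1 c Y : 0 < c -> 2 < c ^ 2 -> 0 < Y < 1 ->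
  0 <= core_base c Y + (1 - 1 / c ^ 2) / 4 * ((1 + c) * Y - 2 * c) ^ 2
    * ((2 * c ^ 2 - 4) / (c ^ 2 * (c - 1) * (1 - Y) + (2 * c ^ 2 - 4) * Y)).
Proof.
intros c0 c2 HY.
assert (c1 : 7 / 5 < c) by nra.
set (den := c ^ 2 * (c - 1) * (1 - Y) + (2 * c ^ 2 - 4) * Y).
assert (d0 : 0 < den).
{ unfold den. assert (0 < c ^ 2 * (c - 1) * (1 - Y)) by (repeat apply Rmult_lt_0_compat; lra).
  assert (0 < (2 * c ^ 2 - 4) * Y) by (apply Rmult_lt_0_compat; lra). lra. }
match goal with |- 0 <= ?f => replace f with
  ((c + 1) * (c - 2) ^ 2 * c ^ 2 * Y *
    ((1 - Y) ^ 2 * (4 * c ^ 2 * (c + 1) ^ 2 * (3 * c - 4))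
     + Y * (1 - Y) * (2 * c ^ 2 * (c + 1) ^ 2 * (5 * c - 7))
     + Y ^ 2 * (2 * (1 + c) * (c ^ 2 - 1) * (c ^ 2 - 2))) / (4 * c ^ 6 * den)) end.
- apply Rmult_le_pos.
  + apply Rmult_le_pos.
    * repeat first [apply pow2_ge_0 | apply pow_le | apply Rmult_le_pos | lra].
    * repeat apply Rplus_le_le_0_compat; repeat apply Rmult_le_pos; try apply pow_le; lra.
  + apply Rlt_le, Rinv_0_lt_compat. apply Rmult_lt_0_compat; [| assumption].
    apply Rmult_lt_0_compat; [lra | apply pow_lt; lra].
- unfold den, core_base, core_factor. field. repeat split; try lra. exact (Rgt_not_eq _ _ d0).
Qed.

(** The case T = 0, with M the value for which the threshold condition is then an
    equality. *)
Lemma overlap_core_T0 c Y : 0 < c -> 2 < c ^ 2 -> 0 < Y < 1 ->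
  0 < core_base c Y + 2 * (2 * c ^ 2 - 4)
      / (2 * ((c + 2) ^ 2 * (c - 1)) - c ^ 2 * (c + 1) * (1 - (1 - Y) ^ 2)) * core_slack c Y.
Proof.
intros c0 c2 HY.
assert (c1 : 7 / 5 < c) by nra.
set (den := 2 * ((c + 2) ^ 2 * (c - 1)) - c ^ 2 * (c + 1) * (1 - (1 - Y) ^ 2)).
assert (d0 : 0 < den).
{ assert (0 < c ^ 2 * (c + 1) * (1 - Y) ^ 2)
    by (repeat apply Rmult_lt_0_compat; try apply pow_lt; lra).
  assert (0 < (c ^ 2 - 2) * c) by (apply Rmult_lt_0_compat; lra).
  unfold den; nra. }
assert (p1 : 0 <= - 128 * c ^ 6 + 32 * c ^ 7 + 96 * c ^ 8 - 24 * c ^ 9 - 16 * c ^ 10 + 8 * c ^ 11).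
{ apply (hform_nonneg [7597301824; 16639198912; 11396778680; 4005018920; 889981120; 148761984; 21538672; 2679440; 250560; 15360; 536; 8]%Z (5 * c - 7) 1 48828125); [reflexivity | lra | lra | lra | simpl; ring]. }
assert (p2 : 0 <= - 128 * c ^ 4 + 64 * c ^ 5 - 144 * c ^ 6 + 32 * c ^ 7 + 140 * c ^ 8 - 36 * c ^ 9 - 20 * c ^ 10 + 12 * c ^ 11).
{ apply (hform_nonneg [16371977216; 34911217768; 22999182920; 7912085580; 1760262480; 295256256; 41366208; 4804360; 419440; 24440; 824; 12]%Z (5 * c - 7) 1 48828125); [reflexivity | lra | lra | lra | simpl; ring]. }
assert (p3 : 0 <= - 224 * c ^ 4 + 128 * c ^ 5 + 16 * c ^ 6 + 24 * c ^ 8 - 20 * c ^ 9 + 8 * c ^ 10 + 4 * c ^ 11).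
{ apply (hform_nonneg [13804866432; 27435881256; 17828927340; 6473093060; 1609947360; 297290912; 40987736; 4101720; 286080; 13080; 348; 4]%Z (5 * c - 7) 1 48828125); [reflexivity | lra | lra | lra | simpl; ring]. }
assert (p4 : 0 <= 64 * c ^ 2 - 48 * c ^ 3 - 240 * c ^ 4 + 184 * c ^ 5 + 116 * c ^ 6 - 68 * c ^ 7 - 44 * c ^ 8 + 4 * c ^ 9 + 16 * c ^ 10).
{ apply (hform_nonneg [1113857024; 2114617400; 1547056480; 699594180; 220397280; 47561044; 6790400; 623740; 35440; 1140; 16]%Z (5 * c - 7) 1 9765625); [reflexivity | lra | lra | lra | simpl; ring]. }
assert (p5 : 0 <= 64 * c ^ 2 - 48 * c ^ 3 - 144 * c ^ 4 + 120 * c ^ 5 + 84 * c ^ 6 - 68 * c ^ 7 - 24 * c ^ 8 + 12 * c ^ 9 + 4 * c ^ 10).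
{ apply (hform_nonneg [107818816; 281844920; 301751860; 186388900; 72464080; 17401716; 2558360; 228380; 12000; 340; 4]%Z (5 * c - 7) 1 9765625); [reflexivity | lra | lra | lra | simpl; ring]. }
assert (p6 : 0 < 4 * (c - 1) * (c ^ 2 - 1) ^ 3 * (c ^ 2 - 2)).
{ repeat apply Rmult_lt_0_compat; try apply pow_lt; lra. }
match goal with |- 0 < ?f => replace f with
  ((c + 1) * Y *
    ((1 - Y) ^ 5 * (- 128 * c ^ 6 + 32 * c ^ 7 + 96 * c ^ 8 - 24 * c ^ 9 - 16 * c ^ 10 + 8 * c ^ 11)
     + Y * (1 - Y) ^ 4 * (- 128 * c ^ 4 + 64 * c ^ 5 - 144 * c ^ 6 + 32 * c ^ 7 + 140 * c ^ 8 - 36 * c ^ 9 - 20 * c ^ 10 + 12 * c ^ 11)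
     + Y ^ 2 * (1 - Y) ^ 3 * (- 224 * c ^ 4 + 128 * c ^ 5 + 16 * c ^ 6 + 24 * c ^ 8 - 20 * c ^ 9 + 8 * c ^ 10 + 4 * c ^ 11)
     + Y ^ 3 * (1 - Y) ^ 2 * (64 * c ^ 2 - 48 * c ^ 3 - 240 * c ^ 4 + 184 * c ^ 5 + 116 * c ^ 6 - 68 * c ^ 7 - 44 * c ^ 8 + 4 * c ^ 9 + 16 * c ^ 10)
     + Y ^ 4 * (1 - Y) * (64 * c ^ 2 - 48 * c ^ 3 - 144 * c ^ 4 + 120 * c ^ 5 + 84 * c ^ 6 - 68 * c ^ 7 - 24 * c ^ 8 + 12 * c ^ 9 + 4 * c ^ 10)
     + Y ^ 5 * (4 * (c - 1) * (c ^ 2 - 1) ^ 3 * (c ^ 2 - 2))) / (4 * (1 - Y) * den * c ^ 8)) end.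
- apply Rdiv_lt_0_compat.
  + apply Rmult_lt_0_compat; [apply Rmult_lt_0_compat; lra |].
    apply Rplus_le_lt_0_compat.
    * repeat apply Rplus_le_le_0_compat; repeat apply Rmult_le_pos;
        try apply pow_le; try assumption; lra.
    * apply Rmult_lt_0_compat; [apply pow_lt; lra | assumption].
  + repeat apply Rmult_lt_0_compat; try apply pow_lt; lra.
- unfold den, core_slack, core_base, core_factor. field. repeat split; try lra. exact (Rgt_not_eq _ _ d0).
Qed.

(** The threshold condition bounds M by an affine function of T, which takes the
    value 1 at T1.  The left side is decreasing in M, and after M is replaced by
    that function it is bounded below by the interpolation between the cases
    T = 0 and T = T1.  For T >= T1 it is at least its value at M = 1 and T1. *)
Lemma overlap_core c Y T M : 0 < c -> 2 < c ^ 2 -> 0 < Y < 1 -> 0 < T -> 0 < M < 1 ->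
  M * ((c + 2) ^ 2 * (c - 1)) <= c ^ 2 * ((c + 1) + (c - 1) * T) ->
  0 < core_base c Y + (1 - 1 / c ^ 2) / 4 * ((1 + c) * Y - 2 * c) ^ 2 * (T / (1 - Y + T * Y))
      + 2 * (1 - M) / (2 - M * (1 - (1 - Y) ^ 2)) * core_slack c Y.
Proof.
intros c0 c2 HY T0 HM HH.
assert (c1 : 7 / 5 < c) by nra.
assert (L0 : 0 < 1 - 1 / c ^ 2).
{ replace (1 - 1 / c ^ 2) with ((c ^ 2 - 1) / c ^ 2) by (field; lra).
  apply Rdiv_lt_0_compat; lra. }
assert (J0 : 0 < core_slack c Y).
{ unfold core_slack, core_factor.
  assert (0 <= (1 - 1 / c ^ 2) * Y ^ 2) by (apply Rmult_le_pos; [lra | apply pow2_ge_0]).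
  assert (0 < (c + 2) * (1 - Y)) by (apply Rmult_lt_0_compat; lra).
  apply Rmult_lt_0_compat; [apply Rmult_lt_0_compat; [lra | apply pow_lt; lra] |].
  assert (0 <= (1 - 1 / c ^ 2) * Y ^ 2 / (4 * (1 - Y)))
    by (apply Rmult_le_pos; [lra | apply Rlt_le, Rinv_0_lt_compat; lra]).
  lra. }
set (v := 1 - (1 - Y) ^ 2).
assert (v0 : 0 < v < 1) by (unfold v; nra).
assert (mv : 0 < 2 - M * v) by nra.
set (q := (1 - 1 / c ^ 2) / 4 * ((1 + c) * Y - 2 * c) ^ 2).
assert (q0 : 0 <= q) by (unfold q; apply Rmult_le_pos; [lra | apply pow2_ge_0]).
set (T1 := (2 * c ^ 2 - 4) / (c ^ 2 * (c - 1))).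
assert (cc : 0 < c ^ 2 * (c - 1)) by (apply Rmult_lt_0_compat; lra).
assert (T1p : 0 < T1) by (apply Rdiv_lt_0_compat; lra).
assert (N1 := overlap_core_M1 c Y c0 c2 HY). assert (N0 := overlap_core_T0 c Y c0 c2 HY).
fold q in N1. fold v in N0.
assert (tp : forall t, 0 < t -> 0 < 1 - Y + t * Y).
{ intros t ht. assert (0 < t * Y) by (apply Rmult_lt_0_compat; lra). lra. }
assert (E1 : (2 * c ^ 2 - 4) / (c ^ 2 * (c - 1) * (1 - Y) + (2 * c ^ 2 - 4) * Y)
   = T1 / (1 - Y + T1 * Y)).
{ assert (h := tp T1 T1p).
  replace (c ^ 2 * (c - 1) * (1 - Y) + (2 * c ^ 2 - 4) * Y)
    with (c ^ 2 * (c - 1) * (1 - Y + T1 * Y)) by (unfold T1; field; lra).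
  unfold T1 at 2. field. repeat split; lra. }
rewrite E1 in N1.
assert (tA := tp T T0). assert (tB := tp T1 T1p).
destruct (Rle_lt_dec T1 T) as [hT | hT].
- assert (T1 / (1 - Y + T1 * Y) <= T / (1 - Y + T * Y)).
  { apply (Rmult_le_reg_r ((1 - Y + T1 * Y) * (1 - Y + T * Y)));
      [apply Rmult_lt_0_compat; assumption |].
    replace (T1 / (1 - Y + T1 * Y) * ((1 - Y + T1 * Y) * (1 - Y + T * Y)))
      with (T1 * (1 - Y + T * Y)) by (field; lra).
    replace (T / (1 - Y + T * Y) * ((1 - Y + T1 * Y) * (1 - Y + T * Y)))
      with (T * (1 - Y + T1 * Y)) by (field; lra).
    nra. }
  assert (q * (T1 / (1 - Y + T1 * Y)) <= q * (T / (1 - Y + T * Y)))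
    by (apply Rmult_le_compat_l; assumption).
  assert (0 < 2 * (1 - M) / (2 - M * v) * core_slack c Y).
  { apply Rmult_lt_0_compat; [apply Rdiv_lt_0_compat; lra | assumption]. }
  lra.
- set (th := T / T1).
  assert (th0 : 0 < th) by (apply Rdiv_lt_0_compat; assumption).
  assert (eT : T = th * T1) by (unfold th; field; lra).
  assert (th1 : th < 1).
  { apply (Rmult_lt_reg_r T1); [assumption | lra]. }
  set (D := (c + 2) ^ 2 * (c - 1)) in *.
  assert (D0 : 0 < D) by (unfold D; apply Rmult_lt_0_compat; [apply pow_lt |]; lra).
  set (mu0 := (2 * c ^ 2 - 4) / D).
  assert (m0 : 0 < mu0) by (apply Rdiv_lt_0_compat; lra).
  assert (hM : (1 - th) * mu0 <= 1 - M).
  { apply (Rmult_le_reg_r D); [assumption |].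
    replace ((1 - th) * mu0 * D) with ((1 - th) * (2 * c ^ 2 - 4)) by (unfold mu0; field; lra).
    assert (c ^ 2 * ((c - 1) * T) = th * (2 * c ^ 2 - 4))
      by (rewrite eT; unfold T1; field; lra).
    unfold D in *. nra. }
  assert (hmu : mu0 < 1).
  { apply (Rmult_lt_reg_r D); [assumption |].
    replace (mu0 * D) with (2 * c ^ 2 - 4) by (unfold mu0; field; lra).
    unfold D. nra. }
  assert (dd : 2 * D - c ^ 2 * (c + 1) * v = D * (2 - (1 - mu0) * v)).
  { unfold mu0. field_simplify; [| lra]. unfold D. ring. }
  rewrite dd in N0.
  assert (mv0 : 0 < 2 - (1 - mu0) * v) by nra.
  assert (E0 : 2 * (2 * c ^ 2 - 4) / (D * (2 - (1 - mu0) * v)) = 2 * mu0 / (2 - (1 - mu0) * v))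
    by (unfold mu0 at 2; field; lra).
  rewrite E0 in N0.
  assert (hJ : (1 - th) * (2 * mu0 / (2 - (1 - mu0) * v)) <= 2 * (1 - M) / (2 - M * v)).
  { apply (Rmult_le_reg_r ((2 - (1 - mu0) * v) * (2 - M * v)));
      [apply Rmult_lt_0_compat; assumption |].
    replace ((1 - th) * (2 * mu0 / (2 - (1 - mu0) * v)) * ((2 - (1 - mu0) * v) * (2 - M * v)))
      with (2 * ((1 - th) * mu0 * (2 - M * v))) by (field; lra).
    replace (2 * (1 - M) / (2 - M * v) * ((2 - (1 - mu0) * v) * (2 - M * v)))
      with (2 * ((1 - M) * (2 - (1 - mu0) * v))) by (field; lra).
    set (mu := 1 - M) in *. replace M with (1 - mu) by (unfold mu; ring).
    set (nu := (1 - th) * mu0) in *.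
    assert (nu <= mu0) by (unfold nu; nra).
    assert (0 <= (mu - nu) * (2 - v)) by (apply Rmult_le_pos; lra).
    assert (0 <= mu * v * (mu0 - nu)).
    { apply Rmult_le_pos; [apply Rmult_le_pos; unfold mu; lra | lra]. }
    lra. }
  assert (hT2 : th * (T1 / (1 - Y + T1 * Y)) <= T / (1 - Y + T * Y)).
  { rewrite eT at 1. unfold Rdiv. rewrite <- Rmult_assoc.
    apply Rmult_le_compat_l; [lra |]. apply Rinv_le_contravar; [assumption |].
    assert (T * Y <= T1 * Y) by (apply Rmult_le_compat_r; lra). lra. }
  assert (A1 : q * (th * (T1 / (1 - Y + T1 * Y))) <= q * (T / (1 - Y + T * Y)))
    by (apply Rmult_le_compat_l; assumption).
  assert (A2 : (1 - th) * (2 * mu0 / (2 - (1 - mu0) * v)) * core_slack c Y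
     <= 2 * (1 - M) / (2 - M * v) * core_slack c Y) by (apply Rmult_le_compat_r; lra).
  assert (A3 : 0 < (1 - th) * (core_base c Y + 2 * mu0 / (2 - (1 - mu0) * v) * core_slack c Y))
    by (apply Rmult_lt_0_compat; lra).
  assert (A4 : 0 <= th * (core_base c Y + q * (T1 / (1 - Y + T1 * Y))))
    by (apply Rmult_le_pos; lra).
  lra.
Qed.

(** Both sides are the same rational function; the right side is written in the
    quantities of the Schur-Cohn condition, with x = k^2 and La = l1 l2 expressed
    through Z = z^2. *)
Lemma overlap_core_eq c Z T M x La : 0 < c -> 2 < c ^ 2 -> 1 < Z -> 0 < T -> 0 < M < 1 ->
  let L := 1 - 1 / c ^ 2 in
  let Y := 1 - / Z in
  x = 1 + L * (Z + / Z - 2) / 4 -> La = L * (Z - / Z) / 4 ->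
  core_base c Y + (1 - 1 / c ^ 2) / 4 * ((1 + c) * Y - 2 * c) ^ 2 * (T / (1 - Y + T * Y))
      + 2 * (1 - M) / (2 - M * (1 - (1 - Y) ^ 2)) * core_slack c Y
  = ((stiffP c x - stiffQ c x * La) ^ 2 + 4 * c * La
     + L / 4 * ((c - 1) ^ 2 * Z + (c + 1) ^ 2 / Z + 2 * (c ^ 2 - 1)) * (T * Z / (1 + T * (Z - 1)))
     - 4 * (stiffP c x * stiffQ c x - c) * La
       / ((Z ^ 2 - 1) * (1 + 2 * (/ M - 1) * Z ^ 2 / (Z ^ 2 + 1)))) / Z.
Proof.
intros c0 c2 hZ hT hM L Y Ex ELa. rewrite Ex, ELa. unfold L, Y.
assert (d1 : 0 < 1 + T * (Z - 1)) by nra.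
assert (Z2 : 1 < Z ^ 2) by nra.
assert (d2 : 0 < 2 * Z ^ 2 - M * (Z ^ 2 - 1)) by nra.
unfold core_base, core_slack, core_factor, stiffP, stiffQ.
field.
repeat split; try lra; try nra.
Qed.

(** * Both waves evanescent: convergence above the threshold *)

(** For real l1, l2, e1, e2 the number conj a0 a1 - a2 conj a1 of [schur_cohn] is
    conj a0 times a number whose real and imaginary parts are explicit. *)
Lemma root_lt1_both_evanescent (P Q c l1 l2 e1 e2 : R) (n : C) :
  0 < c -> 0 < l1 -> 0 < l2 -> 0 < e1 < 1 -> 0 < e2 < 1 ->
  (P + Q * l1 * l2) ^ 2 * (e1 - e2) ^ 2 * (1 + e1 * e2) ^ 2
  + (l1 - c * l2) ^ 2 * (e1 + e2) ^ 2 * (1 - e1 * e2) ^ 2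
  < ((P - Q * l1 * l2) ^ 2 + (l1 + c * l2) ^ 2) * (1 - (e1 * e2) ^ 2) ^ 2 ->
  mode_form P Q c l1 l2 e1 e2 n = 0%C -> Cmod n < 1.
Proof.
intros Hc H1 H2 He1 He2 Hm E.
set (A := P - Q * l1 * l2) in *; set (S := P + Q * l1 * l2) in *.
set (w := l1 + c * l2) in *; set (q := l1 - c * l2) in *.
assert (w0 : 0 < w) by (unfold w; nra).
assert (R0 : 0 < A ^ 2 + w ^ 2) by (assert (0 <= A ^ 2) by apply pow2_ge_0; nra).
assert (p0 : 0 < e1 * e2 < 1) by nra.
set (p := e1 * e2) in *.
apply (schur_cohn (A, - w) (- S * (e1 - e2), - q * (e1 + e2)) (- p * A, - p * w) n).
- rewrite <- E. unfold mode_form, A, S, w, q, p.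
  destruct n; apply injective_projections; simpl; ring.
- unfold nsq; simpl.
  replace (- p * A * (- p * A * 1) + - p * w * (- p * w * 1))
    with (p ^ 2 * (A ^ 2 + w ^ 2)) by ring.
  replace (A * (A * 1) + - w * (- w * 1)) with (A ^ 2 + w ^ 2) by ring.
  assert (p ^ 2 < 1) by nra. nra.
- match goal with |- ?x < ?y =>
    replace x with ((A ^ 2 + w ^ 2) * (S ^ 2 * (e1 - e2) ^ 2 * (1 + p) ^ 2
       + q ^ 2 * (e1 + e2) ^ 2 * (1 - p) ^ 2));
    [replace y with ((A ^ 2 + w ^ 2) * ((A ^ 2 + w ^ 2) * (1 - p ^ 2) ^ 2)) |] end.
  + apply Rmult_lt_compat_l; assumption.
  + unfold nsq; simpl; ring.
  + unfold nsq; simpl; ring.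
Qed.

(** With A = sinh^2 (u z) and B = sinh^2 (u / z) the claim becomes, by
    S^2 - A0^2 = 4 P Q l1 l2 and w^2 - q^2 = 4 c l1 l2 for the sums and differences
    S, A0 = P +- Q l1 l2 and w, q = l1 +- c l2,
    4 (P Q - c) l1 l2 B (1 + A) < (A - B) ((A0^2 + 4 c l1 l2)(1 + A) + q^2 A).
    The bounds for B / (A - B) and A / (1 + A) reduce it to [overlap_core]. *)
Lemma evanescent_gap (c d l1 l2 : R) :
  0 < c -> 2 < c ^ 2 -> 0 < d -> 0 < l1 -> 0 < l2 -> l2 ^ 2 = l1 ^ 2 + (1 - 1 / c ^ 2) ->
  let u := sqrt (1 - 1 / c ^ 2) * d / 2 in
  / xcoth u * ((c + 2) ^ 2 * (c - 1)) <= c ^ 2 * ((c + 1) + (c - 1) * (sinh u / cosh u) ^ 2) ->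
  let P := stiffP c (1 + l1 ^ 2) in
  let Q := stiffQ c (1 + l1 ^ 2) in
  let e1 := exp (- l1 * d) in
  let e2 := exp (- l2 * d) in
  (P + Q * l1 * l2) ^ 2 * (e1 - e2) ^ 2 * (1 + e1 * e2) ^ 2
  + (l1 - c * l2) ^ 2 * (e1 + e2) ^ 2 * (1 - e1 * e2) ^ 2
  < ((P - Q * l1 * l2) ^ 2 + (l1 + c * l2) ^ 2) * (1 - (e1 * e2) ^ 2) ^ 2.
Proof.
intros c0 c2 d0 h1 h2 hl u HH P Q e1 e2.
assert (L0 : 0 < 1 - 1 / c ^ 2).
{ replace (1 - 1 / c ^ 2) with ((c ^ 2 - 1) / c ^ 2) by (field; lra).
  apply Rdiv_lt_0_compat; lra. }
set (l0 := sqrt (1 - 1 / c ^ 2)) in *.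
assert (l00 : 0 < l0) by (apply sqrt_lt_R0; assumption).
assert (l0s : l0 ^ 2 = 1 - 1 / c ^ 2) by (apply pow2_sqrt; lra).
assert (u0 : 0 < u) by (unfold u; apply Rdiv_lt_0_compat; [apply Rmult_lt_0_compat |]; lra).
set (z := (l1 + l2) / l0).
assert (z1 : 1 < z).
{ apply (Rmult_lt_reg_r l0); [assumption |].
  replace (z * l0) with (l1 + l2) by (unfold z; field; lra). nra. }
assert (zi : (l2 - l1) / l0 = / z).
{ unfold z. replace (/ ((l1 + l2) / l0)) with (l0 ^ 2 / (l0 * (l1 + l2))) by (field; split; lra).
  replace (l0 ^ 2) with ((l2 - l1) * (l1 + l2)) by (rewrite l0s; lra).
  field; split; lra. }
assert (Th : u * z = (l1 + l2) * d / 2) by (unfold u, z; field; lra).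
assert (th : u / z = (l2 - l1) * d / 2).
{ unfold Rdiv at 1. rewrite <- zi. unfold u; field; lra. }
assert (zz := sinh_ratio_bound u z u0 (Rlt_le _ _ z1)).
assert (zs := sinh_mul_ge u z u0 (Rlt_le _ _ z1)).
assert (m1 := xcoth_gt1 u u0).
assert (su := sinh_pos u u0).
assert (cu : cosh u ^ 2 = 1 + sinh u ^ 2) by apply cosh_sqr.
assert (cu0 := cosh_gt_sinh u).
assert (sTh : 0 < sinh (u * z)) by (apply sinh_pos, Rmult_lt_0_compat; lra).
assert (sth : 0 < sinh (u / z)) by (apply sinh_pos, Rdiv_lt_0_compat; lra).
set (T := (sinh u / cosh u) ^ 2) in *.
assert (T0 : 0 < T) by (unfold T; apply pow_lt, Rdiv_lt_0_compat; lra).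
set (M := / xcoth u) in *.
assert (M01 : 0 < M < 1).
{ split; [apply Rinv_0_lt_compat; lra |].
  unfold M; rewrite <- Rinv_1. apply Rinv_lt_contravar; lra. }
set (Z := z ^ 2).
assert (Z1 : 1 < Z) by (unfold Z; nra).
set (La := l1 * l2).
assert (La0 : 0 < La) by (apply Rmult_lt_0_compat; assumption).
assert (El1 : l1 = l0 * (z - / z) / 2) by (rewrite <- zi; unfold z; field; lra).
assert (El2 : l2 = l0 * (z + / z) / 2) by (rewrite <- zi; unfold z; field; lra).
assert (ELa : La = (1 - 1 / c ^ 2) * (Z - / Z) / 4).
{ unfold La, Z. rewrite El1, El2, <- l0s. field. lra. }
assert (Ex : 1 + l1 ^ 2 = 1 + (1 - 1 / c ^ 2) * (Z + / Z - 2) / 4).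
{ unfold Z. rewrite El1, <- l0s. field. lra. }
assert (Eq : (1 - 1 / c ^ 2) / 4 * ((c - 1) ^ 2 * Z + (c + 1) ^ 2 / Z + 2 * (c ^ 2 - 1))
   = (l1 - c * l2) ^ 2).
{ unfold Z. rewrite El1, El2, <- l0s. field. lra. }
assert (core := overlap_core c (1 - / Z) T M c0 c2).
assert (Y01 : 0 < 1 - / Z < 1).
{ assert (0 < / Z) by (apply Rinv_0_lt_compat; lra).
  assert (/ Z < 1) by (rewrite <- Rinv_1; apply Rinv_lt_contravar; lra). lra. }
specialize (core Y01 T0 M01 HH).
rewrite (overlap_core_eq c Z T M (1 + l1 ^ 2) La c0 c2 Z1 T0 M01 Ex ELa) in core.
rewrite Eq in core. fold P Q in core.
assert (PQ : 0 <= P * Q - c).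
{ unfold P, Q, stiffP, stiffQ.
  replace (((2 * (1 + l1 ^ 2) - 1) ^ 2 + c * (1 + l1 ^ 2)) * (4 * (1 + l1 ^ 2) + c) - c)
    with ((1 + l1 ^ 2) * (4 * (1 + l1 ^ 2) + c - 2) ^ 2) by ring.
  apply Rmult_le_pos; [nra | apply pow2_ge_0]. }
set (A := sinh (u * z) ^ 2) in *. set (Bb := sinh (u / z) ^ 2) in *.
assert (A0 : 0 < A) by (apply pow_lt; assumption).
assert (B0 : 0 < Bb) by (apply pow_lt; assumption).
replace (z ^ 4) with (Z ^ 2) in zz by (unfold Z; ring).
replace (xcoth u) with (/ M) in zz by (unfold M; apply Rinv_inv).
set (E := (Z ^ 2 - 1) * (1 + 2 * (/ M - 1) * Z ^ 2 / (Z ^ 2 + 1))) in *.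
assert (iM : 1 < / M) by (rewrite <- Rinv_1; apply Rinv_lt_contravar; lra).
assert (E0 : 0 < E).
{ assert (1 < Z ^ 2) by nra. unfold E. apply Rmult_lt_0_compat; [lra |].
  assert (0 < 2 * (/ M - 1) * Z ^ 2 / (Z ^ 2 + 1)); [| lra].
  apply Rdiv_lt_0_compat; [| lra]. apply Rmult_lt_0_compat; lra. }
set (rhs := 4 * (P * Q - c) * La / E) in *.
assert (rE : rhs * E = 4 * (P * Q - c) * La) by (unfold rhs; field; lra).
assert (r0 : 0 <= rhs).
{ unfold rhs. apply Rmult_le_pos; [| apply Rlt_le, Rinv_0_lt_compat; assumption].
  apply Rmult_le_pos; lra. }
assert (AZ : Z * sinh u ^ 2 <= A).
{ unfold Z, A. rewrite <- Rpow_mult_distr. apply pow_incr. split; [nra | assumption]. }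
assert (tanhb : T * Z / (1 + T * (Z - 1)) <= A / (1 + A)).
{ assert (su2 : 0 < sinh u ^ 2) by (apply pow_lt; assumption).
  assert (Zu2 : 0 < Z * sinh u ^ 2) by (apply Rmult_lt_0_compat; lra).
  assert (dT : 1 + T * (Z - 1) = (1 + Z * sinh u ^ 2) / cosh u ^ 2).
  { unfold T. replace ((sinh u / cosh u) ^ 2) with (sinh u ^ 2 / cosh u ^ 2) by (field; lra).
    rewrite cu. field. lra. }
  rewrite dT. unfold T.
  replace ((sinh u / cosh u) ^ 2 * Z / ((1 + Z * sinh u ^ 2) / cosh u ^ 2))
    with (Z * sinh u ^ 2 / (1 + Z * sinh u ^ 2)) by (field; lra).
  set (w := Z * sinh u ^ 2) in *.
  assert (0 < w) by (unfold w; apply Rmult_lt_0_compat; [lra | apply pow_lt; assumption]).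
  apply (Rmult_le_reg_r ((1 + w) * (1 + A))); [apply Rmult_lt_0_compat; lra |].
  replace (w / (1 + w) * ((1 + w) * (1 + A))) with (w * (1 + A)) by (field; lra).
  replace (A / (1 + A) * ((1 + w) * (1 + A))) with (A * (1 + w)) by (field; lra). lra. }
set (S0 := P - Q * La) in *. set (q2 := (l1 - c * l2) ^ 2) in *.
assert (q20 : 0 <= q2) by (unfold q2; apply pow2_ge_0).
assert (c1 : 0 < S0 ^ 2 + 4 * c * La + q2 * (A / (1 + A)) - rhs).
{ assert (q2 * (T * Z / (1 + T * (Z - 1))) <= q2 * (A / (1 + A)))
    by (apply Rmult_le_compat_l; assumption).
  assert (0 < S0 ^ 2 + 4 * c * La + q2 * (T * Z / (1 + T * (Z - 1))) - rhs); [| lra].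
  assert (k := Rmult_lt_0_compat _ _ core (Rlt_trans _ _ _ Rlt_0_1 Z1)).
  assert (cancel : forall v, v / Z * Z = v) by (intros v; field; lra).
  rewrite cancel in k. exact k. }
assert (c3 : rhs * (1 + A) < (S0 ^ 2 + 4 * c * La) * (1 + A) + q2 * A).
{ assert (k := Rmult_lt_0_compat _ _ c1 (ltac:(lra) : 0 < 1 + A)).
  replace ((S0 ^ 2 + 4 * c * La + q2 * (A / (1 + A)) - rhs) * (1 + A))
    with ((S0 ^ 2 + 4 * c * La) * (1 + A) + q2 * A - rhs * (1 + A)) in k by (field; lra). lra. }
(* From here on the factor E of the rational bound replaces (A - Bb) / Bb. *)
assert (AB : Bb * E <= A - Bb) by lra.
assert (AB0 : 0 < A - Bb) by nra.
assert (c4 : 4 * (P * Q - c) * La * (Bb * (1 + A))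
   < (A - Bb) * ((S0 ^ 2 + 4 * c * La) * (1 + A) + q2 * A)).
{ rewrite <- rE.
  apply Rle_lt_trans with ((A - Bb) * (rhs * (1 + A))).
  - replace (rhs * E * (Bb * (1 + A))) with (Bb * E * (rhs * (1 + A))) by ring.
    apply Rmult_le_compat_r; [apply Rmult_le_pos |]; lra.
  - apply Rmult_lt_compat_l; assumption. }
set (p := exp (- (u * z))).
assert (p0 : 0 < p) by apply exp_pos.
assert (Ee1 : e1 = p * exp (u / z)).
{ unfold e1, p. rewrite <- exp_plus, Th, th. f_equal. field. }
assert (Ee2 : e2 = p * exp (- (u / z))).
{ unfold e2, p. rewrite <- exp_plus, Th, th. f_equal. field. }
assert (pp : p * exp (u * z) = 1).
{ unfold p. rewrite <- exp_plus, Rplus_opp_l. apply exp_0. }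
assert (qq : exp (u / z) * exp (- (u / z)) = 1).
{ rewrite <- exp_plus, Rplus_opp_r. apply exp_0. }
assert (E12 : e1 * e2 = p ^ 2).
{ rewrite Ee1, Ee2. transitivity (p ^ 2 * (exp (u / z) * exp (- (u / z)))); [ring |].
  rewrite qq; ring. }
assert (D12 : (e1 - e2) ^ 2 = 4 * p ^ 2 * Bb).
{ unfold Bb, sinh. rewrite Ee1, Ee2. field. }
assert (S12 : (e1 + e2) ^ 2 = 4 * p ^ 2 * (1 + Bb)).
{ unfold Bb. rewrite <- cosh_sqr. unfold cosh. rewrite Ee1, Ee2. field. }
assert (Dp : (1 - p ^ 2) ^ 2 = 4 * p ^ 2 * A).
{ unfold A, sinh. fold p. rewrite <- pp. field. }
assert (Sp : (1 + p ^ 2) ^ 2 = 4 * p ^ 2 * (1 + A)).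
{ unfold A. rewrite <- cosh_sqr. unfold cosh. fold p. rewrite <- pp. field. }
rewrite E12, D12, S12, Dp, Sp.
replace ((1 - (p ^ 2) ^ 2) ^ 2) with ((1 - p ^ 2) ^ 2 * (1 + p ^ 2) ^ 2) by ring.
rewrite Dp, Sp. fold q2.
assert (p4 : 0 < 16 * p ^ 4) by (apply Rmult_lt_0_compat; [lra | apply pow_lt; assumption]).
apply Rlt_0_minus.
match goal with |- 0 < ?f => replace f with (16 * p ^ 4 *
  ((A - Bb) * ((S0 ^ 2 + 4 * c * La) * (1 + A) + q2 * A)
   - 4 * (P * Q - c) * La * (Bb * (1 + A)))) end.
- apply Rmult_lt_0_compat; lra.
- unfold q2, S0, La. ring.
Qed.

(** The equation for al says that x (cosh x + 1 / c) / sinh x has the value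
    (c + 2)^2 (c - 1) / c^3 at x = al.  As this function increases, it is larger at
    2 u; the double angle formulas give the form used here. *)
Lemma threshold_half_angle (c al u : R) : 0 < c -> 2 < c ^ 2 -> 0 < al < 2 * u ->
  al * c ^ 2 * (c * cosh al + 1) = (c + 2) ^ 2 * (c - 1) * sinh al ->
  / xcoth u * ((c + 2) ^ 2 * (c - 1)) <= c ^ 2 * ((c + 1) + (c - 1) * (sinh u / cosh u) ^ 2).
Proof.
intros c0 c2 ha E.
assert (c1 : 1 < c) by nra.
assert (t1 : 0 <= / c <= 1).
{ split; [apply Rlt_le, Rinv_0_lt_compat; lra |].
  rewrite <- Rinv_1. apply Rinv_le_contravar; lra. }
assert (I := alpha_eq_ratio_incr _ _ _ t1 ha).
assert (sa := sinh_pos al (proj1 ha)).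
assert (u0 : 0 < u) by lra.
assert (su := sinh_pos u u0). assert (cu := cosh_gt_sinh u).
assert (s2 : sinh (2 * u) = 2 * sinh u * cosh u).
{ unfold sinh, cosh. replace (2 * u) with (u + u) by ring.
  rewrite Ropp_plus_distr, !exp_plus. field. }
assert (k2 : cosh (2 * u) = cosh u ^ 2 + sinh u ^ 2).
{ assert (h : exp u * exp (- u) = 1) by (rewrite <- exp_plus, Rplus_opp_r; apply exp_0).
  unfold sinh, cosh. replace (2 * u) with (u + u) by ring.
  rewrite Ropp_plus_distr, !exp_plus. field. }
assert (q := cosh_sqr u).
rewrite s2, k2 in I.
replace (al * (cosh al + / c) / sinh al) with ((c + 2) ^ 2 * (c - 1) / c ^ 3) in I.
2: { apply (Rmult_eq_reg_r (c ^ 3 * sinh al)).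
  - transitivity ((c + 2) ^ 2 * (c - 1) * sinh al); [field; lra |].
    rewrite <- E. field. split; lra.
  - apply Rgt_not_eq, Rmult_lt_0_compat; [apply pow_lt |]; lra. }
replace (2 * u * (cosh u ^ 2 + sinh u ^ 2 + / c) / (2 * sinh u * cosh u))
  with (u * ((c + 1) * cosh u ^ 2 + (c - 1) * sinh u ^ 2) / (c * (sinh u * cosh u))) in I.
2: { replace ((c + 1) * cosh u ^ 2 + (c - 1) * sinh u ^ 2)
    with (c * (cosh u ^ 2 + sinh u ^ 2) + (cosh u ^ 2 - sinh u ^ 2)) by ring.
  replace (cosh u ^ 2 - sinh u ^ 2) with 1 by lra. field. repeat split; lra. }
unfold xcoth.
replace (/ (u * cosh u / sinh u)) with (sinh u / (u * cosh u)) by (field; repeat split; lra).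
assert (f : 0 < c ^ 3 * (sinh u / (u * cosh u))).
{ apply Rmult_lt_0_compat; [apply pow_lt; lra | apply Rdiv_lt_0_compat; [lra |]].
  apply Rmult_lt_0_compat; lra. }
assert (R := Rmult_lt_compat_r _ _ _ f I).
apply Rlt_le.
match goal with |- ?x < ?y =>
  replace x with ((c + 2) ^ 2 * (c - 1) / c ^ 3 * (c ^ 3 * (sinh u / (u * cosh u))));
  [replace y with (u * ((c + 1) * cosh u ^ 2 + (c - 1) * sinh u ^ 2) / (c * (sinh u * cosh u))
      * (c ^ 3 * (sinh u / (u * cosh u)))) |] end.
- exact R.
- field. repeat split; lra.
- field. repeat split; lra.
Qed.

Lemma rho_lt1_both_evanescent (sg Cs c k delta al : R) :
  0 < sg -> 0 < Cs -> 0 < c -> 2 < c ^ 2 -> 0 < delta -> 1 < k ^ 2 ->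
  0 < al < sqrt (1 - 1 / c ^ 2) * (sg * delta) ->
  al * c ^ 2 * (c * cosh al + 1) = (c + 2) ^ 2 * (c - 1) * sinh al ->
  rho_T0 (sg * k) (sg * Cs) (c * Cs) Cs delta < 1.
Proof.
intros hs hC hc c2 hd hk hal E.
assert (c2i : 1 / c ^ 2 < 1).
{ apply (Rmult_lt_reg_r (c ^ 2)); [lra |].
  replace (1 / c ^ 2 * c ^ 2) with 1 by (field; lra). lra. }
set (l1 := sqrt (k ^ 2 - 1)). set (l2 := sqrt (k ^ 2 - 1 / c ^ 2)).
assert (h1 : 0 < l1) by (apply sqrt_lt_R0; lra).
assert (h2 : 0 < l2) by (apply sqrt_lt_R0; lra).
assert (s1 : l1 ^ 2 = k ^ 2 - 1) by (apply pow2_sqrt; lra).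
assert (s2 : l2 ^ 2 = k ^ 2 - 1 / c ^ 2) by (apply pow2_sqrt; lra).
assert (d0 : 0 < sg * delta) by (apply Rmult_lt_0_compat; assumption).
apply (rho_lt1_of_mode_form sg Cs c k delta l1 l2); try assumption.
- apply Csqrt_scaled_pos; lra.
- apply Csqrt_scaled_pos; lra.
- intros h. apply (f_equal Im) in h. rewrite Im_mode_den_evanescent in h.
  assert (0 < c * l2) by (apply Rmult_lt_0_compat; assumption). change (Im 0%C) with 0 in h; lra.
- intros n. rewrite !Cexp_evanescent.
  assert (ex : forall l, 0 < l -> 0 < exp (- l * (sg * delta)) < 1).
  { intros l hl. split; [apply exp_pos |]. rewrite <- exp_0. apply exp_increasing.
    assert (0 < l * (sg * delta)) by (apply Rmult_lt_0_compat; assumption). lra. }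
  apply root_lt1_both_evanescent; try assumption; try (apply ex; assumption).
  replace (k ^ 2) with (1 + l1 ^ 2) by lra.
  apply evanescent_gap; try assumption; [lra |].
  apply (threshold_half_angle c al); try assumption. lra.
Qed.

(** * The convergence theorem *)

Theorem theorem3p5 :
  forall lambda mu rho omega : R,
    0 < lambda -> 0 < mu -> 0 < rho -> 0 < omega ->
    let Cp := sqrt ((lambda + 2 * mu) / rho) in
    let Cs := sqrt (mu / rho) in
    forall alpha : R,
      0 < alpha ->
      alpha_eq_printed Cp Cs alpha \/ alpha_eq_corrected Cp Cs alpha ->
      forall delta : R,
        0 < delta ->
        delta_star Cp Cs omega alpha < delta ->
        forall k : R,
          0 <= k -> k <> omega / Cp -> k <> omega / Cs ->
          rho_T0 k omega Cp Cs delta < 1.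
Proof.
intros lambda mu rho omega hl hm hr ho Cp Cs alpha ha HA delta hd Hd k hk kp ks.
assert (Cs0 : 0 < Cs) by (apply sqrt_lt_R0, Rdiv_lt_0_compat; assumption).
assert (Cp0 : 0 < Cp) by (apply sqrt_lt_R0, Rdiv_lt_0_compat; lra).
assert (Cs2 : Cs ^ 2 = mu / rho) by (apply pow2_sqrt, Rlt_le, Rdiv_lt_0_compat; assumption).
assert (Cp2 : Cp ^ 2 = (lambda + 2 * mu) / rho)
  by (apply pow2_sqrt, Rlt_le, Rdiv_lt_0_compat; lra).
assert (ratio : 2 * Cs ^ 2 < Cp ^ 2).
{ rewrite Cs2, Cp2. assert (0 < lambda / rho) by (apply Rdiv_lt_0_compat; assumption).
  replace ((lambda + 2 * mu) / rho) with (lambda / rho + 2 * (mu / rho)) by (field; lra). lra. }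
destruct HA as [HA | HA]; [exfalso; exact (alpha_eq_printed_no_root _ _ _ Cs0 Cp0 ratio ha HA) |].
clearbody Cp Cs. clear Cs2 Cp2.
set (sg := omega / Cs). set (c := Cp / Cs). set (x := k / sg).
assert (sg0 : 0 < sg) by (apply Rdiv_lt_0_compat; assumption).
assert (c0 : 0 < c) by (apply Rdiv_lt_0_compat; assumption).
assert (eo : omega = sg * Cs) by (unfold sg; field; lra).
assert (ec : Cp = c * Cs) by (unfold c; field; lra).
assert (ek : k = sg * x) by (unfold x; field; lra).
clearbody sg c x. subst omega Cp k.
assert (x0 : 0 <= x) by (destruct (Rle_lt_dec 0 x); [assumption | nra]).
assert (c2 : 2 < c ^ 2).
{ assert (0 < Cs ^ 2) by (apply pow_lt; assumption). nra. }
assert (c2i : 1 / c ^ 2 < 1).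
{ apply (Rmult_lt_reg_r (c ^ 2)); [lra |].
  replace (1 / c ^ 2 * c ^ 2) with 1 by (field; lra). lra. }
assert (x1 : x <> 1).
{ intros e; apply ks; rewrite e; field; lra. }
assert (xc : x <> / c).
{ intros e; apply kp; rewrite e; field; lra. }
assert (ic : 0 < / c) by (apply Rinv_0_lt_compat; assumption).
assert (ic2 : 1 / c ^ 2 = (/ c) ^ 2) by (field; lra).
destruct (Rlt_le_dec x (/ c)) as [l | l].
{ apply rho_lt1_both_propagating; try assumption. rewrite ic2. nra. }
destruct (Rlt_le_dec x 1) as [l' | l'].
{ apply rho_lt1_mixed; try assumption. rewrite ic2. split; nra. }
apply (rho_lt1_both_evanescent sg Cs c x delta alpha); try assumption.
- nra.
- split; [assumption |].
  unfold alpha_eq_corrected, delta_star in *.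
  assert (K : alpha * c ^ 2 * (c * cosh alpha + 1) = (c + 2) ^ 2 * (c - 1) * sinh alpha).
  { apply (Rmult_eq_reg_r (Cs ^ 3)); [| apply pow_nonzero; lra].
    replace ((c + 2) ^ 2 * (c - 1) * sinh alpha * Cs ^ 3)
      with (((c * Cs) ^ 3 + (3 * (c * Cs) ^ 2 * Cs - 4 * Cs ^ 3)) * sinh alpha) by ring.
    lra. }
  assert (c1 : 1 < c) by nra.
  assert (ca : 0 < c * cosh alpha + 1).
  { assert (g := sinh_pos alpha ha). assert (g' := cosh_gt_sinh alpha).
    assert (0 < c * cosh alpha) by (apply Rmult_lt_0_compat; lra). lra. }
  set (l0 := sqrt (1 - 1 / c ^ 2)).
  assert (l00 : 0 < l0) by (apply sqrt_lt_R0; lra).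
  assert (l0s : l0 * l0 = (c ^ 2 - 1) / c ^ 2).
  { unfold l0. rewrite sqrt_sqrt by lra. field. lra. }
  assert (es : sqrt ((c * Cs) ^ 2 - Cs ^ 2) = c * Cs * l0).
  { apply sqrt_lem_1.
    - assert (0 < Cs ^ 2) by (apply pow_lt; assumption). nra.
    - repeat apply Rmult_le_pos; lra.
    - transitivity ((c * Cs) ^ 2 * (l0 * l0)); [ring |]. rewrite l0s. field. lra. }
  rewrite es in Hd.
  assert (Hm := Rmult_lt_compat_l (l0 * sg) _ _ (Rmult_lt_0_compat _ _ l00 sg0) Hd).
  match type of Hm with ?v < _ => replace v with alpha in Hm end; [lra |].
  apply (Rmult_eq_reg_r (c ^ 2 * (c * cosh alpha + 1))).
  2: { apply Rgt_not_eq, Rmult_lt_0_compat; lra. }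
  transitivity ((c + 2) ^ 2 * (c - 1) * sinh alpha); [lra |].
  transitivity ((l0 * l0) * c ^ 2 * (c + 2) ^ 2 / (c + 1) * sinh alpha).
  + rewrite l0s. field. lra.
  + field. repeat split; try lra.
    replace (c * Cs * cosh alpha + Cs) with (Cs * (c * cosh alpha + 1)) by ring.
    apply Rgt_not_eq, Rmult_lt_0_compat; lra.
- unfold alpha_eq_corrected in HA.
  apply (Rmult_eq_reg_r (Cs ^ 3)); [| apply pow_nonzero; lra].
  replace ((c + 2) ^ 2 * (c - 1) * sinh alpha * Cs ^ 3)
    with (((c * Cs) ^ 3 + (3 * (c * Cs) ^ 2 * Cs - 4 * Cs ^ 3)) * sinh alpha) by ring.
  lra.
Qed.
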